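(* Let $k$ be an algebraically closed field, $n\geq 2$ an integer not divisible by the characteristic of $k$, and $q\in k$ a primitive $n$-th root of unity. Let $G$ be a finite group, $x\in G$ a central element of order $n$, and $\chi : G\to k^{\times}$ a homomorphism such that $\chi^n=1$ and $\chi(x)=q$, and let $H$ be the monomial Hopf algebra of type $I$ associated to these data. Let $\sigma,\sigma'\in Z^2(G,k^{\times})$ be normalized two-cocycles and $c,c'\in k$. If $$\mathrm{Id}_{H}(A_{\sigma,c}) = \mathrm{Id}_{H}(A_{\sigma',c'}),$$ then $A_{\sigma,c}$ and $A_{\sigma',c'}$ are isomorphic $H$-comodule algebras.
   Context: All algebras are associative and unital, and all tensor products are over $k$; $k^\times = k\setminus\{0\}$. For a Hopf algebra $H$ over $k$ with coproduct $\Delta$, write $\Delta(h) = h_1\otimes h_2$ (implicit sum). A (right) $H$-comodule algebra is an algebra $A$ with a right $H$-comodule structure whose coaction $\delta : A\to A\otimes H$ is an algebra map; $H$-comodule algebra maps are algebra maps that are $H$-colinear. Polynomial identities: for each $i=1,2,\ldots$ let $X_i^H$ be a copy of the vector space $H$, whose element corresponding to $h\in H$ is denoted $X_i^h$ (linear in $h$). Let $T=T\bigl(\bigoplus_{i\geq 1}X_i^H\bigr)$ be the tensor algebra; it is an $H$-comodule algebra with coaction $\delta(X_i^h)=X_i^{h_1}\otimes h_2$. An element $P\in T$ is a polynomial $H$-identity for an $H$-comodule algebra $A$ if $\mu(P)=0$ for all $H$-comodule algebra maps $\mu : T\to A$. The set of all polynomial $H$-identities for $A$ is denoted $\mathrm{Id}_H(A)\subset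 T$. Monomial Hopf algebra of type $I$: as an algebra, $H$ is the quotient of the free product $kG * k[y]$ by the two-sided ideal generated by the relations $y^n=0$ and $yg=\chi(g)\,gy$ for all $g\in G$. The elements $gy^i$ ($g\in G$, $0\leq i\leq n-1$) form a basis of $H$. The group algebra $kG$ is a Hopf subalgebra of $H$, and $\Delta(y)=1\otimes y+y\otimes x$, $\varepsilon(y)=0$, $S(y)=-yx^{-1}$. The comodule algebra $A_{\sigma,c}$: for a normalized two-cocycle $\sigma\in Z^2(G,k^\times)$ (trivial action of $G$ on $k^\times$; normalized means $\sigma(1,g)=\sigma(g,1)=1$ for all $g \in G$) and $c\in k$, $A_{\sigma,c}$ is the algebra generated by symbols $u_y$ and $u_g$ ($g\in G$) with relations $u_1=1$, $u_gu_h=\sigma(g,h)\,u_{gh}$, $u_y^n=c$, $u_yu_g=\chi(g)\,u_gu_y$ for all $g,h\in G$. It is an $H$-comodule algebra with coaction $\delta(u_y)=1\otimes y+u_y\otimes x$ and $\delta(u_g)=u_g\otimes g$ for all $g\in G$. *)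

(* Defs.v *)
From HB Require Import structures.
From mathcomp Require Import all_boot all_order all_algebra all_fingroup all_solvable.
From mathcomp Require Import boolp classical_sets.

From mathcomp Require Import ring.

Set Implicit Arguments.
Unset Strict Implicit.
Unset Printing Implicit Defensive.

Import GRing.Theory.
Local Open Scope quotient_scope.
Local Open Scope ring_scope.

(* [algType] demands [1 != 0].  The associative unital algebras below are
   allowed to be zero, so that algebras can be given by generators and
   relations. *)

Record pzAlgType (k : fieldType) := PzAlg {
  alg_mod : lmodType k;
  alg_one : alg_mod;
  alg_mul : alg_mod -> alg_mod -> alg_mod;
  alg_mulA : associative alg_mul;
  alg_mul1l : left_id alg_one alg_mul;
  alg_mul1r : right_id alg_one alg_mul;
  alg_mulDl : left_distributive alg_mul +%R;
  alg_mulDr : right_distributive alg_mul +%R;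
  alg_scaleAl : forall a u v, a *: alg_mul u v = alg_mul (a *: u) v;
  alg_scaleAr : forall a u v, a *: alg_mul u v = alg_mul u (a *: v)
}.

Definition alg_sort (k : fieldType) (A : pzAlgType k) : Type := alg_mod A.
Coercion alg_sort : pzAlgType >-> Sortclass.

HB.instance Definition _ (k : fieldType) (A : pzAlgType k) :=
  GRing.Lmodule.copy (alg_sort A) (alg_mod A).
HB.instance Definition _ (k : fieldType) (A : pzAlgType k) :=
  GRing.Zmodule_isPzRing.Build (alg_sort A) (@alg_mulA k A) (@alg_mul1l k A)
    (@alg_mul1r k A) (@alg_mulDl k A) (@alg_mulDr k A).

Lemma pzscalerAl (k : fieldType) (A : pzAlgType k) (a : k) (u v : A) :
  a *: (u * v) = (a *: u) * v.
Proof. exact: alg_scaleAl. Qed.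

Lemma pzscalerAr (k : fieldType) (A : pzAlgType k) (a : k) (u v : A) :
  a *: (u * v) = u * (a *: v).
Proof. exact: alg_scaleAr. Qed.

Definition regAlg (k : fieldType) : pzAlgType k :=
  @PzAlg k k^o 1 *%R (@mulrA k) (@mul1r k) (@mulr1 k) (@mulrDl k) (@mulrDr k)
    (@mulrA k) (@mulrCA k).

Record algHom (k : fieldType) (A B : pzAlgType k) := AlgHom {
  algHom_fun :> A -> B;
  algHom_linear : linear algHom_fun;
  algHom_mul : {morph algHom_fun : u v / u * v};
  algHom_one : algHom_fun 1 = 1
}.

Section LinearFacts.
Variables (k : fieldType) (U V : lmodType k) (f : U -> V).
Hypothesis lf : linear f.

Lemma linD u v : f (u + v) = f u + f v.
Proof. by rewrite -[u]scale1r lf !scale1r. Qed.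

Lemma lin0 : f 0 = 0.
Proof. by apply: (addIr (f 0)); rewrite -linD !add0r. Qed.

Lemma linZ a u : f (a *: u) = a *: f u.
Proof. by rewrite -[a *: u]addr0 lf lin0 addr0. Qed.

End LinearFacts.

Lemma lin_id (k : fieldType) (U : lmodType k) : linear (@id U).
Proof. by []. Qed.

Lemma lin_comp (k : fieldType) (U V W : lmodType k) (f : V -> W) (g : U -> V) :
  linear f -> linear g -> linear (f \o g).
Proof. by move=> lf lg a u v; rewrite /= lg lf. Qed.

Definition alg_comp (k : fieldType) (A B C : pzAlgType k)
  (g : algHom B C) (f : algHom A B) : algHom A C.
Proof.
apply: (@AlgHom _ _ _ (g \o f)).
- exact: lin_comp (algHom_linear g) (algHom_linear f).
- by move=> u v; rewrite /= !algHom_mul.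
- by rewrite /= !algHom_one.
Defined.

Definition alg_id (k : fieldType) (A : pzAlgType k) : algHom A A :=
  @AlgHom k A A id (@lin_id k A) (fun _ _ => erefl) erefl.

Lemma alg_exp (k : fieldType) (A B : pzAlgType k) (f : algHom A B) u m :
  f (u ^+ m) = f u ^+ m.
Proof.
elim: m => [|m IH]; first by rewrite !expr0 algHom_one.
by rewrite !exprS algHom_mul IH.
Qed.

Lemma alg_scal1 (k : fieldType) (A B : pzAlgType k) (f : algHom A B) a :
  f (a *: (1 : A)) = a *: (1 : B).
Proof. by rewrite (linZ (algHom_linear f)) algHom_one. Qed.

Inductive term (k X : Type) : Type :=
| Gen of X
| Cst of k
| Add of term k X & term k X
| Mul of term k X & term k X.

Arguments Gen {k X}.
Arguments Cst {k X}.

HB.instance Definition _ (k X : Type) := gen_eqMixin (term k X).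
HB.instance Definition _ (k X : Type) := gen_choiceMixin (term k X).

Declare Scope alg_term_scope.
Delimit Scope alg_term_scope with alg.
Bind Scope alg_term_scope with term.
Notation "s + t" := (Add s t) : alg_term_scope.
Notation "s * t" := (Mul s t) : alg_term_scope.
Notation "a %:C" := (Cst a%R) (at level 1, format "a %:C") : alg_term_scope.
Definition term_exp (k : fieldType) (X : Type) (t : term k X) (m : nat) :=
  iter m (Mul t) (Cst 1).
Notation "t ^+ m" := (term_exp t m) : alg_term_scope.

(* The least congruence containing [R] whose quotient is a k-algebra, with
   scalar multiplication [a *: t = a%:C * t]. *)
Inductive pres_eq (k : fieldType) (X : Type) (R : term k X -> term k X -> Prop) :
  term k X -> term k X -> Prop :=
| pe_rel s t : R s t -> pres_eq R s t
| pe_refl t : pres_eq R t t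
| pe_sym s t : pres_eq R s t -> pres_eq R t s
| pe_trans s t u : pres_eq R s t -> pres_eq R t u -> pres_eq R s u
| pe_add s s' t t' :
    pres_eq R s s' -> pres_eq R t t' -> pres_eq R (s + t)%alg (s' + t')%alg
| pe_mul s s' t t' :
    pres_eq R s s' -> pres_eq R t t' -> pres_eq R (s * t)%alg (s' * t')%alg
| pe_addA s t u : pres_eq R (s + (t + u))%alg (s + t + u)%alg
| pe_addC s t : pres_eq R (s + t)%alg (t + s)%alg
| pe_add0 t : pres_eq R (0%:C + t)%alg t
| pe_addN t : pres_eq R ((-1)%:C * t + t)%alg 0%:C%alg
| pe_mulA s t u : pres_eq R (s * (t * u))%alg (s * t * u)%alg
| pe_mul1 t : pres_eq R (1%:C * t)%alg t
| pe_mulDl s t u : pres_eq R ((s + t) * u)%alg (s * u + t * u)%alg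
| pe_mulDr s t u : pres_eq R (s * (t + u))%alg (s * t + s * u)%alg
| pe_cstD a b : pres_eq R (a + b)%R%:C%alg (a%:C + b%:C)%alg
| pe_cstM a b : pres_eq R (a * b)%R%:C%alg (a%:C * b%:C)%alg
| pe_cstC a t : pres_eq R (a%:C * t)%alg (t * a%:C)%alg.

Section PresentedAlgebra.
Variables (k : fieldType) (X : Type) (R : term k X -> term k X -> Prop).

Definition pres_rel : rel (term k X) := fun s t => `[< pres_eq R s t >].

Lemma pres_rel_equiv : equiv_class_of pres_rel.
Proof.
split.
- by move=> t; apply/asboolP; exact: pe_refl.
- by move=> s t; apply/asboolP/asboolP; exact: pe_sym.
- move=> t s u /asboolP st /asboolP tu; apply/asboolP; exact: pe_trans st tu.
Qed.

Canonical pres_equiv := EquivRelPack pres_rel_equiv.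

Definition presCar : Type := {eq_quot pres_equiv}.

HB.instance Definition _ := Choice.on presCar.

Definition pres_pi (t : term k X) : presCar := \pi_{eq_quot pres_equiv} t.

Lemma pres_piP s t : pres_pi s = pres_pi t <-> pres_eq R s t.
Proof.
split; first by move/eqmodP/asboolP.
by move=> h; apply/eqmodP/asboolP.
Qed.

Let rep (a : presCar) : term k X := generic_quotient.repr (a : {eq_quot pres_equiv}).

Lemma pres_repK a : pres_pi (rep a) = a.
Proof. exact: generic_quotient.reprK. Qed.

Lemma pres_ind (P : presCar -> Prop) : (forall t, P (pres_pi t)) -> forall a, P a.
Proof. by move=> h a; rewrite -[a]pres_repK. Qed.

Lemma pres_rep_pi t : pres_eq R (rep (pres_pi t)) t.
Proof. by apply/pres_piP; rewrite pres_repK. Qed.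

Definition pres_zero : presCar := pres_pi 0%:C.
Definition pres_one : presCar := pres_pi 1%:C.
Definition pres_add (a b : presCar) := pres_pi (rep a + rep b).
Definition pres_mul (a b : presCar) := pres_pi (rep a * rep b).
Definition pres_scale (c : k) (a : presCar) := pres_pi (c%:C * rep a).
Definition pres_opp (a : presCar) := pres_scale (-1) a.

Lemma pres_addE s t : pres_add (pres_pi s) (pres_pi t) = pres_pi (s + t).
Proof. by apply/pres_piP/pe_add; exact: pres_rep_pi. Qed.

Lemma pres_mulE s t : pres_mul (pres_pi s) (pres_pi t) = pres_pi (s * t).
Proof. by apply/pres_piP/pe_mul; exact: pres_rep_pi. Qed.

Lemma pres_scaleE c t : pres_scale c (pres_pi t) = pres_pi (c%:C * t).
Proof. by apply/pres_piP/pe_mul; [exact: pe_refl | exact: pres_rep_pi]. Qed.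

Lemma pres_addA : associative pres_add.
Proof.
elim/pres_ind => s; elim/pres_ind => t; elim/pres_ind => u.
by rewrite !pres_addE; apply/pres_piP; exact: pe_addA.
Qed.
Lemma pres_addC : commutative pres_add.
Proof.
elim/pres_ind => s; elim/pres_ind => t.
by rewrite !pres_addE; apply/pres_piP; exact: pe_addC.
Qed.
Lemma pres_add0 : left_id pres_zero pres_add.
Proof.
by elim/pres_ind => s; rewrite pres_addE; apply/pres_piP; exact: pe_add0.
Qed.
Lemma pres_addN : left_inverse pres_zero pres_opp pres_add.
Proof.
elim/pres_ind => s; rewrite /pres_opp pres_scaleE pres_addE.
by apply/pres_piP; exact: pe_addN.
Qed.

HB.instance Definition _ := GRing.isZmodule.Build presCar
  pres_addA pres_addC pres_add0 pres_addN.

Lemma pres_mulA : associative pres_mul.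
Proof.
elim/pres_ind => s; elim/pres_ind => t; elim/pres_ind => u.
by rewrite !pres_mulE; apply/pres_piP; exact: pe_mulA.
Qed.
Lemma pres_mul1 : left_id pres_one pres_mul.
Proof.
by elim/pres_ind => s; rewrite pres_mulE; apply/pres_piP; exact: pe_mul1.
Qed.
Lemma pres_mulr1 : right_id pres_one pres_mul.
Proof.
elim/pres_ind => s; rewrite pres_mulE; apply/pres_piP.
by apply: pe_trans (pe_mul1 R s); apply: pe_sym; exact: pe_cstC.
Qed.
Lemma pres_mulDl : left_distributive pres_mul pres_add.
Proof.
elim/pres_ind => s; elim/pres_ind => t; elim/pres_ind => u.
by rewrite ?(pres_addE, pres_mulE); apply/pres_piP; exact: pe_mulDl.
Qed.
Lemma pres_mulDr : right_distributive pres_mul pres_add.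
Proof.
elim/pres_ind => s; elim/pres_ind => t; elim/pres_ind => u.
by rewrite ?(pres_addE, pres_mulE); apply/pres_piP; exact: pe_mulDr.
Qed.

Lemma pres_scaleA a b v : pres_scale a (pres_scale b v) = pres_scale (a * b) v.
Proof.
elim/pres_ind: v => t; rewrite !pres_scaleE; apply/pres_piP.
apply: pe_trans (pe_mulA R _ _ _) _; apply: pe_mul (pe_refl R t).
by apply: pe_sym; exact: pe_cstM.
Qed.
Lemma pres_scale1 : left_id 1 pres_scale.
Proof.
by elim/pres_ind => t; rewrite pres_scaleE; apply/pres_piP; exact: pe_mul1.
Qed.
Lemma pres_scaleDr : right_distributive pres_scale +%R.
Proof.
move=> a; elim/pres_ind => s; elim/pres_ind => t.
rewrite /GRing.add /= ?(pres_addE, pres_scaleE).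
by apply/pres_piP; exact: pe_mulDr.
Qed.
Lemma pres_scaleDl v : {morph pres_scale^~ v : a b / a + b}.
Proof.
move=> a b; elim/pres_ind: v => t.
rewrite [RHS]/GRing.add /= ?(pres_addE, pres_scaleE); apply/pres_piP.
apply: pe_trans (pe_mulDl R _ _ _).
by apply: pe_mul (pe_refl R t); exact: pe_cstD.
Qed.

HB.instance Definition _ := GRing.Zmodule_isLmodule.Build k presCar
  pres_scaleA pres_scale1 pres_scaleDr pres_scaleDl.

Lemma pres_scaleAl (a : k) (u v : presCar) :
  a *: pres_mul u v = pres_mul (a *: u) v.
Proof.
elim/pres_ind: u => s; elim/pres_ind: v => t.
rewrite /GRing.scale /= ?(pres_mulE, pres_scaleE).
by apply/pres_piP; exact: pe_mulA.
Qed.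
Lemma pres_scaleAr (a : k) (u v : presCar) :
  a *: pres_mul u v = pres_mul u (a *: v).
Proof.
elim/pres_ind: u => s; elim/pres_ind: v => t.
rewrite /GRing.scale /= ?(pres_mulE, pres_scaleE).
apply/pres_piP; apply: pe_trans (pe_mulA R _ _ _) _.
apply: pe_trans (pe_mul (pe_cstC R _ _) (pe_refl R t)) _.
by apply: pe_sym; exact: pe_mulA.
Qed.

Definition presAlg : pzAlgType k :=
  @PzAlg k presCar pres_one pres_mul pres_mulA pres_mul1 pres_mulr1
    pres_mulDl pres_mulDr pres_scaleAl pres_scaleAr.

Definition pgen (i : X) : presAlg := pres_pi (Gen i).

Fixpoint term_eval (B : pzAlgType k) (f : X -> B) (t : term k X) : B :=
  match t with
  | Gen i => f i
  | Cst c => c *: (1 : B)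
  | Add s t => term_eval f s + term_eval f t
  | Mul s t => term_eval f s * term_eval f t
  end.

Lemma term_eval_exp (B : pzAlgType k) (f : X -> B) t m :
  term_eval f (t ^+ m)%alg = term_eval f t ^+ m.
Proof.
elim: m => [|m IH] /=; first by rewrite expr0 scale1r.
by rewrite exprS -IH.
Qed.

Lemma pres_pi_eval t : pres_pi t = term_eval pgen t.
Proof.
elim: t => [i|c|s IHs t IHt|s IHs t IHt] //=.
- rewrite [RHS]pres_scaleE; apply/pres_piP.
  by apply: pe_trans (pe_cstC R _ _); apply: pe_sym; exact: pe_mul1.
- by rewrite -IHs -IHt [RHS]pres_addE.
- by rewrite -IHs -IHt [RHS]pres_mulE.
Qed.

Lemma pgen_rel s t : R s t -> term_eval pgen s = term_eval pgen t.
Proof. by move=> h; rewrite -!pres_pi_eval; apply/pres_piP; exact: pe_rel. Qed.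

Section Lift.
Variables (B : pzAlgType k) (f : X -> B).
Hypothesis f_rel : forall s t, R s t -> term_eval f s = term_eval f t.

Lemma term_eval_eq s t : pres_eq R s t -> term_eval f s = term_eval f t.
Proof.
have cl (a : k) (u : B) : (a *: (1 : B)) * u = a *: u by rewrite -pzscalerAl mul1r.
have cr (a : k) (u : B) : u * (a *: (1 : B)) = a *: u by rewrite -pzscalerAr mulr1.
elim=> {s t} //=.
- by move=> s t u _ -> _ ->.
- by move=> s s' t t' _ -> _ ->.
- by move=> s s' t t' _ -> _ ->.
- by move=> *; rewrite addrA.
- by move=> *; rewrite addrC.
- by move=> *; rewrite scale0r add0r.
- by move=> *; rewrite cl scaleN1r addNr scale0r.
- by move=> *; rewrite mulrA.
- by move=> *; rewrite scale1r mul1r.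
- by move=> *; rewrite mulrDl.
- by move=> *; rewrite mulrDr.
- by move=> *; rewrite scalerDl.
- by move=> *; rewrite cl scalerA.
- by move=> *; rewrite cl cr.
Qed.

Definition pres_lift_fun (a : presAlg) : B := term_eval f (rep a).

Lemma pres_lift_pi t : pres_lift_fun (pres_pi t) = term_eval f t.
Proof. by apply: term_eval_eq; exact: pres_rep_pi. Qed.

Lemma pres_lift_linear : linear pres_lift_fun.
Proof.
move=> a; elim/pres_ind => s; elim/pres_ind => t.
rewrite [a *: _]pres_scaleE [_ + _]pres_addE !pres_lift_pi /=.
by rewrite -pzscalerAl mul1r.
Qed.

Lemma pres_lift_mul : {morph pres_lift_fun : u v / u * v}.
Proof.
elim/pres_ind => s; elim/pres_ind => t.
by rewrite [_ * _]pres_mulE !pres_lift_pi.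
Qed.

Lemma pres_lift_one : pres_lift_fun 1 = 1.
Proof. by rewrite [1]/(pres_pi 1%:C) pres_lift_pi /= scale1r. Qed.

Definition pres_lift : algHom presAlg B :=
  AlgHom pres_lift_linear pres_lift_mul pres_lift_one.

Lemma pres_lift_gen i : pres_lift (pgen i) = f i.
Proof. exact: pres_lift_pi. Qed.

End Lift.

Lemma pres_hom_ext (B : pzAlgType k) (f g : algHom presAlg B) :
  (forall i, f (pgen i) = g (pgen i)) -> forall a, f a = g a.
Proof.
move=> fg; elim/pres_ind => t; rewrite pres_pi_eval.
elim: t => [i|c|s IHs t IHt|s IHs t IHt] //=.
- by rewrite !alg_scal1.
- by rewrite !(linD (algHom_linear _)) IHs IHt.
- by rewrite !algHom_mul IHs IHt.
Qed.

End PresentedAlgebra.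

Inductive tterm (k V W : Type) : Type :=
| TPure of V & W
| TZero
| TAdd of tterm k V W & tterm k V W
| TScale of k & tterm k V W.

Arguments TPure {k V W}.
Arguments TZero {k V W}.

HB.instance Definition _ (k V W : Type) := gen_eqMixin (tterm k V W).
HB.instance Definition _ (k V W : Type) := gen_choiceMixin (tterm k V W).

(* The least congruence whose quotient is a vector space in which
   [TPure v w] is bilinear. *)
Inductive tens_eq (k : fieldType) (V W : lmodType k) :
  tterm k V W -> tterm k V W -> Prop :=
| te_refl t : tens_eq t t
| te_sym s t : tens_eq s t -> tens_eq t s
| te_trans s t u : tens_eq s t -> tens_eq t u -> tens_eq s u
| te_add s s' t t' :
    tens_eq s s' -> tens_eq t t' -> tens_eq (TAdd s t) (TAdd s' t')
| te_scale a t t' : tens_eq t t' -> tens_eq (TScale a t) (TScale a t')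
| te_addA s t u : tens_eq (TAdd s (TAdd t u)) (TAdd (TAdd s t) u)
| te_addC s t : tens_eq (TAdd s t) (TAdd t s)
| te_add0 t : tens_eq (TAdd TZero t) t
| te_addN t : tens_eq (TAdd (TScale (-1) t) t) TZero
| te_scaleA a b t : tens_eq (TScale a (TScale b t)) (TScale (a * b) t)
| te_scale1 t : tens_eq (TScale 1 t) t
| te_scaleDr a s t :
    tens_eq (TScale a (TAdd s t)) (TAdd (TScale a s) (TScale a t))
| te_scaleDl a b t : tens_eq (TScale (a + b) t) (TAdd (TScale a t) (TScale b t))
| te_pureDl v v' w : tens_eq (TPure (v + v') w) (TAdd (TPure v w) (TPure v' w))
| te_pureDr v w w' : tens_eq (TPure v (w + w')) (TAdd (TPure v w) (TPure v w'))
| te_pureZl a v w : tens_eq (TPure (a *: v) w) (TScale a (TPure v w))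
| te_pureZr a v w : tens_eq (TPure v (a *: w)) (TScale a (TPure v w)).

Definition bilin (k : fieldType) (V W U : lmodType k) (f : V -> W -> U) : Prop :=
  (forall v, linear (f v)) /\ (forall w, linear (f^~ w)).

Section TensorModule.
Variables (k : fieldType) (V W : lmodType k).
Notation tt := (tterm k V W).

Definition tens_rel : rel tt := fun s t => `[< tens_eq s t >].

Lemma tens_rel_equiv : equiv_class_of tens_rel.
Proof.
split.
- by move=> t; apply/asboolP; exact: te_refl.
- by move=> s t; apply/asboolP/asboolP; exact: te_sym.
- move=> t s u /asboolP st /asboolP tu; apply/asboolP; exact: te_trans st tu.
Qed.

Canonical tens_equiv := EquivRelPack tens_rel_equiv.

Definition tensor : Type := {eq_quot tens_equiv}.

HB.instance Definition _ := Choice.on tensor.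

Definition tens_pi (t : tt) : tensor := \pi_{eq_quot tens_equiv} t.

Lemma tens_piP s t : tens_pi s = tens_pi t <-> tens_eq s t.
Proof.
split; first by move/eqmodP/asboolP.
by move=> h; apply/eqmodP/asboolP.
Qed.

Let rep (a : tensor) : tt := generic_quotient.repr (a : {eq_quot tens_equiv}).

Lemma tens_repK a : tens_pi (rep a) = a.
Proof. exact: generic_quotient.reprK. Qed.

Lemma tens_pi_ind (P : tensor -> Prop) :
  (forall t, P (tens_pi t)) -> forall a, P a.
Proof. by move=> h a; rewrite -[a]tens_repK. Qed.

Lemma tens_rep_pi t : tens_eq (rep (tens_pi t)) t.
Proof. by apply/tens_piP; rewrite tens_repK. Qed.

Definition tens_zero : tensor := tens_pi TZero.
Definition tens_add (a b : tensor) := tens_pi (TAdd (rep a) (rep b)).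
Definition tens_scale (c : k) (a : tensor) := tens_pi (TScale c (rep a)).
Definition tens_opp (a : tensor) := tens_scale (-1) a.

Lemma tens_addE s t : tens_add (tens_pi s) (tens_pi t) = tens_pi (TAdd s t).
Proof. by apply/tens_piP/te_add; exact: tens_rep_pi. Qed.

Lemma tens_scaleE c t : tens_scale c (tens_pi t) = tens_pi (TScale c t).
Proof. by apply/tens_piP/te_scale; exact: tens_rep_pi. Qed.

Lemma tens_addA : associative tens_add.
Proof.
elim/tens_pi_ind => s; elim/tens_pi_ind => t; elim/tens_pi_ind => u.
by rewrite !tens_addE; apply/tens_piP; exact: te_addA.
Qed.
Lemma tens_addC : commutative tens_add.
Proof.
elim/tens_pi_ind => s; elim/tens_pi_ind => t.
by rewrite !tens_addE; apply/tens_piP; exact: te_addC.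
Qed.
Lemma tens_add0 : left_id tens_zero tens_add.
Proof.
by elim/tens_pi_ind => s; rewrite tens_addE; apply/tens_piP; exact: te_add0.
Qed.
Lemma tens_addN : left_inverse tens_zero tens_opp tens_add.
Proof.
elim/tens_pi_ind => s; rewrite /tens_opp tens_scaleE tens_addE.
by apply/tens_piP; exact: te_addN.
Qed.

HB.instance Definition _ := GRing.isZmodule.Build tensor
  tens_addA tens_addC tens_add0 tens_addN.

Lemma tens_scaleA a b v : tens_scale a (tens_scale b v) = tens_scale (a * b) v.
Proof.
elim/tens_pi_ind: v => t; rewrite !tens_scaleE; apply/tens_piP.
exact: te_scaleA.
Qed.
Lemma tens_scale1 : left_id 1 tens_scale.
Proof.
by elim/tens_pi_ind => t; rewrite tens_scaleE; apply/tens_piP; exact: te_scale1.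
Qed.
Lemma tens_scaleDr : right_distributive tens_scale +%R.
Proof.
move=> a; elim/tens_pi_ind => s; elim/tens_pi_ind => t.
rewrite /GRing.add /= ?(tens_addE, tens_scaleE).
by apply/tens_piP; exact: te_scaleDr.
Qed.
Lemma tens_scaleDl v : {morph tens_scale^~ v : a b / a + b}.
Proof.
move=> a b; elim/tens_pi_ind: v => t.
rewrite [RHS]/GRing.add /= ?(tens_addE, tens_scaleE); apply/tens_piP.
exact: te_scaleDl.
Qed.

HB.instance Definition _ := GRing.Zmodule_isLmodule.Build k tensor
  tens_scaleA tens_scale1 tens_scaleDr tens_scaleDl.

Definition tens (v : V) (w : W) : tensor := tens_pi (TPure v w).

Lemma tensDl v v' w : tens (v + v') w = tens v w + tens v' w.
Proof. by rewrite [RHS]tens_addE; apply/tens_piP; exact: te_pureDl. Qed.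
Lemma tensDr v w w' : tens v (w + w') = tens v w + tens v w'.
Proof. by rewrite [RHS]tens_addE; apply/tens_piP; exact: te_pureDr. Qed.
Lemma tensZl a v w : tens (a *: v) w = a *: tens v w.
Proof. by rewrite [RHS]tens_scaleE; apply/tens_piP; exact: te_pureZl. Qed.
Lemma tensZr a v w : tens v (a *: w) = a *: tens v w.
Proof. by rewrite [RHS]tens_scaleE; apply/tens_piP; exact: te_pureZr. Qed.

Lemma tens_bilin : bilin tens.
Proof.
by split=> [v|w] a u u'; rewrite ?(tensDl, tensDr) ?(tensZl, tensZr).
Qed.

Lemma tens_ind (P : tensor -> Prop) :
  (forall v w, P (tens v w)) -> P 0 ->
  (forall s t, P s -> P t -> P (s + t)) ->
  (forall a t, P t -> P (a *: t)) -> forall t, P t.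
Proof.
move=> Pp P0 Pa Ps; elim/tens_pi_ind; elim=> [v w||s IHs t IHt|a t IHt].
- exact: Pp.
- exact: P0.
- by rewrite -tens_addE; exact: Pa.
- by rewrite -tens_scaleE; exact: Ps.
Qed.

Fixpoint tterm_eval (U : lmodType k) (f : V -> W -> U) (t : tt) : U :=
  match t with
  | TPure v w => f v w
  | TZero => 0
  | TAdd s t => tterm_eval f s + tterm_eval f t
  | TScale a t => a *: tterm_eval f t
  end.

(* The linear map [tensor -> U] induced by [f]; meaningful for bilinear [f]. *)
Definition tlift (U : lmodType k) (f : V -> W -> U) (t : tensor) : U :=
  tterm_eval f (rep t).

Section Lift.
Variables (U : lmodType k) (f : V -> W -> U).
Hypothesis bf : bilin f.

Lemma tterm_eval_eq s t : tens_eq s t -> tterm_eval f s = tterm_eval f t.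
Proof.
have [fr fl] := bf.
elim=> {s t} //=.
- by move=> s t u _ -> _ ->.
- by move=> s s' t t' _ -> _ ->.
- by move=> a t t' _ ->.
- by move=> *; rewrite addrA.
- by move=> *; rewrite addrC.
- by move=> *; rewrite add0r.
- by move=> *; rewrite scaleN1r addNr.
- by move=> *; rewrite scalerA.
- by move=> *; rewrite scale1r.
- by move=> *; rewrite scalerDr.
- by move=> *; rewrite scalerDl.
- by move=> v v' w; exact: (linD (fl w)).
- by move=> v w w'; exact: (linD (fr v)).
- by move=> a v w; exact: (linZ (fl w)).
- by move=> a v w; exact: (linZ (fr v)).
Qed.

Lemma tlift_pi t : tlift f (tens_pi t) = tterm_eval f t.
Proof. by apply: tterm_eval_eq; exact: tens_rep_pi. Qed.

Lemma tlift_tens v w : tlift f (tens v w) = f v w.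
Proof. exact: tlift_pi. Qed.

Lemma tlift_linear : linear (tlift f).
Proof.
move=> a; elim/tens_pi_ind => s; elim/tens_pi_ind => t.
by rewrite [a *: _]tens_scaleE [_ + _]tens_addE !tlift_pi.
Qed.

End Lift.

Lemma tens_lin_ext (U : lmodType k) (f g : tensor -> U) : linear f -> linear g ->
  (forall v w, f (tens v w) = g (tens v w)) -> forall t, f t = g t.
Proof.
move=> lf lg fg; elim/tens_ind => [v w||s t IHs IHt|a t IHt].
- exact: fg.
- by rewrite !lin0.
- by rewrite !linD // IHs IHt.
- by rewrite !linZ // IHt.
Qed.

End TensorModule.

Notation "v ⊗ w" := (tens v w) (at level 40, left associativity) : ring_scope.

Section TensorMap.
Variables (k : fieldType).
Implicit Types V W U : lmodType k.

Definition tmap V W V' W' (f : V -> V') (g : W -> W') :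
    tensor V W -> tensor V' W' := tlift (fun v w => f v ⊗ g w).

Definition tassoc V W U : tensor (tensor V W) U -> tensor V (tensor W U) :=
  tlift (fun s u => tlift (fun v w => v ⊗ (w ⊗ u)) s).

Lemma tmap_bilin V W V' W' (f : V -> V') (g : W -> W') :
  linear f -> linear g -> bilin (fun v w => f v ⊗ g w).
Proof.
move=> lf lg; split=> [v|w] a u u'.
  by rewrite lg tensDr tensZr.
by rewrite lf tensDl tensZl.
Qed.

Lemma tmap_tens V W V' W' (f : V -> V') (g : W -> W') v w :
  linear f -> linear g -> tmap f g (v ⊗ w) = f v ⊗ g w.
Proof. by move=> lf lg; rewrite /tmap tlift_tens //; exact: tmap_bilin. Qed.

Lemma tmap_linear V W V' W' (f : V -> V') (g : W -> W') :
  linear f -> linear g -> linear (tmap f g).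
Proof. by move=> lf lg; apply: tlift_linear; exact: tmap_bilin. Qed.

Lemma tassoc_bilin1 V W U (u : U) :
  bilin (fun (v : V) (w : W) => v ⊗ (w ⊗ u)).
Proof.
split=> [v|w] a s t; first by rewrite tensDl tensZl tensDr tensZr.
by rewrite tensDl tensZl.
Qed.

Lemma tassoc_bilin V W U :
  bilin (fun (s : tensor V W) (u : U) => tlift (fun v w => v ⊗ (w ⊗ u)) s).
Proof.
split=> [s|u]; last by apply: tlift_linear; exact: tassoc_bilin1.
move=> a u u'; move: s.
apply: tens_lin_ext => [||v w].
- by apply: tlift_linear; exact: tassoc_bilin1.
- move=> b s t; rewrite !(tlift_linear (@tassoc_bilin1 V W U _)).
  by rewrite !scalerDr !scalerA [a * b]mulrC addrACA.
- by rewrite !tlift_tens ?tensDr ?tensZr; do ?exact: tassoc_bilin1.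
Qed.

Lemma tassoc_tens V W U (v : V) (w : W) (u : U) :
  tassoc ((v ⊗ w) ⊗ u) = v ⊗ (w ⊗ u).
Proof.
rewrite /tassoc tlift_tens; last exact: tassoc_bilin.
by rewrite tlift_tens //; exact: tassoc_bilin1.
Qed.

Lemma tassoc_linear V W U : linear (@tassoc V W U).
Proof. by apply: tlift_linear; exact: tassoc_bilin. Qed.

Lemma tens_linl V W (w : W) : linear (fun v : V => v ⊗ w).
Proof. by move=> a v v'; rewrite tensDl tensZl. Qed.

Lemma tens_linr V W (v : V) : linear (fun w : W => v ⊗ w).
Proof. by move=> a w w'; rewrite tensDr tensZr. Qed.

Lemma tens0l V W (w : W) : (0 : V) ⊗ w = 0.
Proof. exact: (lin0 (tens_linl _)). Qed.

Lemma tens0r V W (v : V) : v ⊗ (0 : W) = 0.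
Proof. exact: (lin0 (tens_linr _)). Qed.

Lemma tmap_id V W t : tmap (@id V) (@id W) t = t.
Proof.
move: t; apply: tens_lin_ext => //; first exact: tmap_linear.
by move=> v w; rewrite tmap_tens.
Qed.

Lemma tmap_comp V W V' W' V'' W'' (f : V -> V') (g : W -> W')
    (f' : V' -> V'') (g' : W' -> W'') t :
  linear f -> linear g -> linear f' -> linear g' ->
  tmap f' g' (tmap f g t) = tmap (f' \o f) (g' \o g) t.
Proof.
move=> lf lg lf' lg'; move: t; apply: tens_lin_ext => [||v w].
- by apply: (@lin_comp _ _ _ _ (tmap f' g')); apply: tmap_linear.
- by apply: tmap_linear; apply: lin_comp.
- by rewrite !tmap_tens //; apply: lin_comp.
Qed.

Lemma tassoc_nat V W U V' W' U' (f : V -> V') (g : W -> W') (h : U -> U') t :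
  linear f -> linear g -> linear h ->
  tassoc (tmap (tmap f g) h t) = tmap f (tmap g h) (tassoc t).
Proof.
move=> lf lg lh.
have l1 := tmap_linear lf lg; have l2 := tmap_linear lg lh.
move: t; apply: tens_lin_ext.
- apply: (@lin_comp _ _ _ _ (@tassoc _ _ _)); first exact: tassoc_linear.
  exact: tmap_linear.
- apply: (@lin_comp _ _ _ _ _ (@tassoc _ _ _)); last exact: tassoc_linear.
  exact: tmap_linear.
move=> s u; move: s; apply: tens_lin_ext => [a s t|a s t|v w].
- rewrite tensDl tensZl (tmap_linear l1 lh) tassoc_linear //.
- by rewrite tensDl tensZl tassoc_linear (tmap_linear lf l2).
- by rewrite tassoc_tens !tmap_tens // tassoc_tens.
Qed.

End TensorMap.

Definition lmul (k : fieldType) (C : pzAlgType k) (a u : C) : C := a * u.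

Section TensorAlgebraStructure.
Variables (k : fieldType) (A B : pzAlgType k).
Notation AB := (tensor A B).

Definition tens_one : AB := (1 : A) ⊗ (1 : B).
Definition tens_mul (s t : AB) : AB :=
  tlift (fun (a : A) (b : B) => tmap (lmul a) (lmul b) t) s.

Lemma mull_linear (C : pzAlgType k) (a : C) : linear (lmul a).
Proof. by move=> c u v; rewrite /lmul mulrDr -pzscalerAr. Qed.

Lemma alg_mul_linr (C : pzAlgType k) (a : C) (c : k) (u v : C) :
  a * (c *: u + v) = c *: (a * u) + a * v.
Proof. exact: mull_linear. Qed.

Lemma mulr_linear (C : pzAlgType k) (a : C) : linear (fun u : C => u * a).
Proof. by move=> c u v; rewrite mulrDl -pzscalerAl. Qed.

Lemma tens_mul_bilin (t : AB) : bilin (fun (a : A) (b : B) => tmap (lmul a) (lmul b) t).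
Proof.
have lt (a : A) (b : B) : linear (tmap (lmul a) (lmul b) : AB -> AB).
  by apply: tmap_linear; exact: mull_linear.
split=> [a|b] c u v; move: t; apply: tens_lin_ext => //.
- move=> d s t; rewrite !lt.
  by rewrite !scalerDr !scalerA [c * d]mulrC addrACA.
- move=> a' b'; rewrite !tmap_tens; do ?exact: mull_linear.
  by rewrite /lmul mulr_linear tensDr tensZr.
- move=> d s t; rewrite !lt.
  by rewrite !scalerDr !scalerA [c * d]mulrC addrACA.
- move=> a' b'; rewrite !tmap_tens; do ?exact: mull_linear.
  by rewrite /lmul mulr_linear tensDl tensZl.
Qed.

Lemma tens_mul_linl t : linear (tens_mul^~ t).
Proof. exact/tlift_linear/tens_mul_bilin. Qed.

Lemma tens_mul_linr s : linear (tens_mul s).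
Proof.
move=> c t t'; move: s; apply: tens_lin_ext.
- exact: tens_mul_linl.
- move=> d s s'; rewrite !tens_mul_linl.
  by rewrite !scalerDr !scalerA [c * d]mulrC addrACA.
move=> a b; rewrite /tens_mul !tlift_tens; do ?exact: tens_mul_bilin.
by rewrite tmap_linear; do ?exact: mull_linear.
Qed.

Lemma tens_mulE (a a' : A) (b b' : B) :
  tens_mul (a ⊗ b) (a' ⊗ b') = (a * a') ⊗ (b * b').
Proof.
rewrite /tens_mul tlift_tens; last exact: tens_mul_bilin.
by rewrite tmap_tens //; exact: mull_linear.
Qed.

Lemma tens_mulA : associative tens_mul.
Proof.
move=> s t u; move: s; apply: tens_lin_ext.
- exact: tens_mul_linl.
- by move=> c s s'; rewrite !tens_mul_linl.
move=> a b; move: t; apply: tens_lin_ext.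
- by move=> c t t'; rewrite tens_mul_linl tens_mul_linr.
- by move=> c t t'; rewrite tens_mul_linr tens_mul_linl.
move=> a' b'; move: u; apply: tens_lin_ext.
- by move=> c u u'; rewrite !tens_mul_linr.
- exact: tens_mul_linr.
by move=> a'' b''; rewrite !tens_mulE !mulrA.
Qed.

Lemma tens_mul1 : left_id tens_one tens_mul.
Proof.
apply: tens_lin_ext => //; first exact: tens_mul_linr.
by move=> a b; rewrite tens_mulE !mul1r.
Qed.

Lemma tens_mulr1 : right_id tens_one tens_mul.
Proof.
apply: tens_lin_ext => //; first exact: tens_mul_linl.
by move=> a b; rewrite tens_mulE !mulr1.
Qed.

Lemma tens_mulDl : left_distributive tens_mul +%R.
Proof. by move=> s t u; exact: (linD (tens_mul_linl u)). Qed.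

Lemma tens_mulDr : right_distributive tens_mul +%R.
Proof. by move=> s t u; exact: (linD (tens_mul_linr s)). Qed.

Lemma tens_scaleAl (a : k) (u v : AB) : a *: tens_mul u v = tens_mul (a *: u) v.
Proof. by rewrite (linZ (tens_mul_linl v)). Qed.

Lemma tens_scaleAr (a : k) (u v : AB) : a *: tens_mul u v = tens_mul u (a *: v).
Proof. by rewrite (linZ (tens_mul_linr u)). Qed.

Definition tensorAlg : pzAlgType k :=
  @PzAlg k AB tens_one tens_mul tens_mulA tens_mul1 tens_mulr1
    tens_mulDl tens_mulDr tens_scaleAl tens_scaleAr.

Lemma tensM (a a' : A) (b b' : B) :
  (a ⊗ b : tensorAlg) * (a' ⊗ b') = (a * a') ⊗ (b * b').
Proof. exact: tens_mulE. Qed.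

Lemma tens1 : (1 : tensorAlg) = (1 : A) ⊗ (1 : B).
Proof. by []. Qed.

Lemma tensX (a : A) (b : B) m : (a ⊗ b : tensorAlg) ^+ m = (a ^+ m) ⊗ (b ^+ m).
Proof. by elim: m => [|m IH] //; rewrite !exprS IH tensM. Qed.

Lemma tens_alg_ext_mul (C : pzAlgType k) (f : tensorAlg -> C) : linear f ->
  (forall a b a' b', f ((a ⊗ b : tensorAlg) * (a' ⊗ b')) = f (a ⊗ b) * f (a' ⊗ b')) ->
  {morph f : u v / u * v}.
Proof.
move=> lf fM u v; move: u; apply: tens_lin_ext.
- by move=> c u u'; rewrite mulr_linear lf.
- by move=> c u u'; rewrite lf mulr_linear.
move=> a b; move: v; apply: tens_lin_ext.
- by move=> c v v'; rewrite alg_mul_linr lf.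
- by move=> c v v'; rewrite lf alg_mul_linr.
by move=> a' b'; exact: fM.
Qed.

End TensorAlgebraStructure.

Section TensorAlgHom.
Variable k : fieldType.

Lemma tmap_mul (A B A' B' : pzAlgType k) (f : algHom A A') (g : algHom B B') :
  {morph (tmap f g : tensorAlg A B -> tensorAlg A' B') : u v / u * v}.
Proof.
have lf := algHom_linear f; have lg := algHom_linear g.
apply: tens_alg_ext_mul; first exact: tmap_linear.
by move=> a b a' b'; rewrite tensM !tmap_tens // !algHom_mul tensM.
Qed.

Lemma tmap_one (A B A' B' : pzAlgType k) (f : algHom A A') (g : algHom B B') :
  tmap f g (1 : tensorAlg A B) = (1 : tensorAlg A' B').
Proof.
by rewrite tmap_tens; do ?exact: algHom_linear; rewrite !algHom_one.
Qed.

Definition tmap_alg (A B A' B' : pzAlgType k) (f : algHom A A')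
    (g : algHom B B') : algHom (tensorAlg A B) (tensorAlg A' B') :=
  @AlgHom k (tensorAlg A B) (tensorAlg A' B') (tmap f g)
    (tmap_linear (algHom_linear f) (algHom_linear g)) (tmap_mul f g) (tmap_one f g).

Lemma tassoc_mul (A B C : pzAlgType k) :
  {morph (@tassoc k A B C :
    tensorAlg (tensorAlg A B) C -> tensorAlg A (tensorAlg B C)) : u v / u * v}.
Proof.
apply: tens_alg_ext_mul; first exact: tassoc_linear.
move=> s c s' c'; rewrite tensM; move: s; apply: tens_lin_ext.
- move=> d s t; rewrite mulr_linear tens_linl tassoc_linear //.
- by move=> d s t; rewrite tens_linl tassoc_linear mulr_linear.
move=> a b; move: s'; apply: tens_lin_ext.
- move=> d s t; rewrite alg_mul_linr tens_linl tassoc_linear //.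
- by move=> d s t; rewrite tens_linl tassoc_linear alg_mul_linr.
by move=> a' b'; rewrite tensM !tassoc_tens !tensM.
Qed.

Lemma tassoc_one (A B C : pzAlgType k) : 
  @tassoc k A B C (1 : tensorAlg (tensorAlg A B) C) =
  (1 : tensorAlg A (tensorAlg B C)).
Proof. exact: tassoc_tens. Qed.

Definition tassoc_alg (A B C : pzAlgType k) :
    algHom (tensorAlg (tensorAlg A B) C) (tensorAlg A (tensorAlg B C)) :=
  @AlgHom k (tensorAlg (tensorAlg A B) C) (tensorAlg A (tensorAlg B C))
    (@tassoc k A B C) (@tassoc_linear k A B C) (@tassoc_mul A B C) (@tassoc_one A B C).

(* [a ⊗ h |-> eps h *: a], i.e. [id ⊗ eps] followed by [A ⊗ k = A]. *)
Definition tcontr (A H : pzAlgType k) (eps : H -> k) : tensor A H -> A :=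
  tlift (fun a h => eps h *: a).

(* [h ⊗ a |-> eps h *: a], i.e. [eps ⊗ id] followed by [k ⊗ A = A]. *)
Definition tcontl (A H : pzAlgType k) (eps : H -> k) : tensor H A -> A :=
  tlift (fun h a => eps h *: a).

Section Contraction.
Variables (A H : pzAlgType k) (eps : algHom H (regAlg k)).

Lemma tcontr_bilin : bilin (fun (a : A) (h : H) => (eps h : k) *: a).
Proof.
split=> [a|h] c u v; last by rewrite scalerDr !scalerA mulrC.
by rewrite algHom_linear scalerDl scalerA.
Qed.

Lemma tcontl_bilin : bilin (fun (h : H) (a : A) => (eps h : k) *: a).
Proof. by have [? ?] := tcontr_bilin. Qed.

Lemma tcontr_tens (a : A) h : tcontr eps (a ⊗ h) = (eps h : k) *: a.
Proof. by rewrite /tcontr tlift_tens //; exact: tcontr_bilin. Qed.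

Lemma tcontl_tens (a : A) h : tcontl eps (h ⊗ a) = (eps h : k) *: a.
Proof. by rewrite /tcontl tlift_tens //; exact: tcontl_bilin. Qed.

Lemma tcontr_linear : linear (@tcontr A H eps).
Proof. by apply: tlift_linear; exact: tcontr_bilin. Qed.

Lemma tcontl_linear : linear (@tcontl A H eps).
Proof. by apply: tlift_linear; exact: tcontl_bilin. Qed.

Lemma tcontr_mul : {morph (@tcontr A H eps : tensorAlg A H -> A) : u v / u * v}.
Proof.
apply: tens_alg_ext_mul; first exact: tcontr_linear.
move=> a h a' h'; rewrite tensM !tcontr_tens algHom_mul.
by rewrite -pzscalerAl -pzscalerAr scalerA.
Qed.

Lemma tcontl_mul : {morph (@tcontl A H eps : tensorAlg H A -> A) : u v / u * v}.
Proof.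
apply: tens_alg_ext_mul; first exact: tcontl_linear.
move=> a h a' h'; rewrite tensM !tcontl_tens algHom_mul.
by rewrite -pzscalerAl -pzscalerAr scalerA.
Qed.

Lemma tcontr_one : @tcontr A H eps (1 : tensorAlg A H) = 1.
Proof. by rewrite tcontr_tens algHom_one scale1r. Qed.

Lemma tcontl_one : @tcontl A H eps (1 : tensorAlg H A) = 1.
Proof. by rewrite tcontl_tens algHom_one scale1r. Qed.

Definition tcontr_alg : algHom (tensorAlg A H) A :=
  @AlgHom k (tensorAlg A H) A (@tcontr A H eps) tcontr_linear tcontr_mul tcontr_one.
Definition tcontl_alg : algHom (tensorAlg H A) A :=
  @AlgHom k (tensorAlg H A) A (@tcontl A H eps) tcontl_linear tcontl_mul tcontl_one.

End Contraction.

End TensorAlgHom.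

Record hopfAlg (k : fieldType) := HopfAlg {
  hopf_alg :> pzAlgType k;
  comul : algHom hopf_alg (tensorAlg hopf_alg hopf_alg);
  counit : algHom hopf_alg (regAlg k);
  antipode : hopf_alg -> hopf_alg;
  comulA : forall h,
    tassoc (tmap comul (@id hopf_alg) (comul h)) = tmap (@id hopf_alg) comul (comul h);
  comul_counitl : forall h, tcontl counit (comul h) = h;
  comul_counitr : forall h, tcontr counit (comul h) = h;
  antipode_linear : linear antipode;
  antipodel : forall h,
    tlift (fun a b : hopf_alg => antipode a * b) (comul h) =
    (counit h : k) *: (1 : hopf_alg);
  antipoder : forall h,
    tlift (fun a b : hopf_alg => a * antipode b) (comul h) =
    (counit h : k) *: (1 : hopf_alg)
}.

Record comodAlg (k : fieldType) (H : hopfAlg k) := ComodAlg {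
  comod_alg :> pzAlgType k;
  coact : algHom comod_alg (tensorAlg comod_alg H);
  coactA : forall a,
    tassoc (tmap coact (@id H) (coact a)) = tmap (@id comod_alg) (comul H) (coact a);
  coact_counit : forall a, tcontr (counit H) (coact a) = a
}.

Record comodAlgHom (k : fieldType) (H : hopfAlg k) (A B : comodAlg H) :=
  ComodAlgHom {
  comod_hom :> algHom A B;
  comod_hom_colinear : forall a, coact B (comod_hom a) = tmap comod_hom (@id H) (coact A a)
}.

Definition comodAlg_isomorphic (k : fieldType) (H : hopfAlg k)
    (A B : comodAlg H) : Prop :=
  exists f : comodAlgHom A B, bijective f.

(* The tensor algebra on a direct sum of copies of [H] indexed by [nat] is
   generated by symbols [X_i^h], linear in [h]. *)
Inductive talg_rel (k : fieldType) (H : lmodType k) :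
  term k (nat * H) -> term k (nat * H) -> Prop :=
| talgD i g h : talg_rel (Gen (i, g + h)) (Gen (i, g) + Gen (i, h))%alg
| talgZ i a h : talg_rel (Gen (i, a *: h)) (a%:C * Gen (i, h))%alg.

Section TensorAlgebraOfH.
Variables (k : fieldType) (H : hopfAlg k).

Definition tensAlg : pzAlgType k := presAlg (@talg_rel k H).

(* [Xvar i] is X_(i+1). *)
Definition Xvar (i : nat) (h : H) : tensAlg := pgen (@talg_rel k H) (i, h).

Lemma Xvar_linear i : linear (Xvar i).
Proof.
have XD g h : Xvar i (g + h) = Xvar i g + Xvar i h.
  exact: (pgen_rel (talgD i g h)).
have XZ a h : Xvar i (a *: h) = a *: Xvar i h.
  have := pgen_rel (talgZ i a h).
  by rewrite /= -pzscalerAl mul1r.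
by move=> a g h; rewrite XD XZ.
Qed.

Definition talg_coact_gen (p : nat * H) : tensorAlg tensAlg H :=
  tmap (Xvar p.1) (@id H) (comul H p.2).

Lemma talg_coact_rel s t : talg_rel s t ->
  term_eval talg_coact_gen s = term_eval talg_coact_gen t.
Proof.
have lX i := tmap_linear (Xvar_linear i) (@lin_id _ H).
have lD := algHom_linear (comul H).
case=> [i g h|i a h] /=; rewrite /talg_coact_gen /=.
  by rewrite (linD lD) (linD (lX i)).
by rewrite (linZ lD) (linZ (lX i)) -pzscalerAl mul1r.
Qed.

Definition talg_coact : algHom tensAlg (tensorAlg tensAlg H) :=
  pres_lift talg_coact_rel.

Lemma talg_coactX i h : talg_coact (Xvar i h) = tmap (Xvar i) (@id H) (comul H h).
Proof. exact: (pres_lift_gen talg_coact_rel). Qed.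

Lemma talg_coactA a : tassoc (tmap talg_coact (@id H) (talg_coact a)) =
  tmap (@id tensAlg) (comul H) (talg_coact a).
Proof.
pose f := alg_comp (tassoc_alg _ _ _)
  (alg_comp (tmap_alg talg_coact (alg_id H)) talg_coact).
pose g := alg_comp (tmap_alg (alg_id tensAlg) (comul H)) talg_coact.
apply: (@pres_hom_ext _ _ _ _ f g) => -[i h].
change (tassoc (tmap talg_coact (@id H) (talg_coact (Xvar i h))) =
  tmap (@id tensAlg) (comul H) (talg_coact (Xvar i h))).
rewrite talg_coactX.
have lc := algHom_linear talg_coact; have lD := algHom_linear (comul H).
have lX := Xvar_linear i; have lH := @lin_id _ H.
rewrite !tmap_comp //.
have -> : (talg_coact \o Xvar i) = (tmap (Xvar i) (@id H) \o comul H).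
  by apply/funext => h'; exact: talg_coactX.
rewrite -(@tmap_comp _ _ _ _ _ _ _ (comul H) id) //; last exact: tmap_linear.
rewrite tassoc_nat // comulA tmap_comp //; last exact: tmap_linear.
congr tmap; apply/funext => t /=; exact: tmap_id.
Qed.

Lemma talg_coact_counit a : tcontr (counit H) (talg_coact a) = a.
Proof.
pose f := alg_comp (tcontr_alg tensAlg (counit H)) talg_coact.
apply: (@pres_hom_ext _ _ _ _ f (alg_id _)) => -[i h].
change (tcontr (counit H) (talg_coact (Xvar i h)) = Xvar i h).
rewrite talg_coactX.
have lX := Xvar_linear i.
rewrite -[in RHS](comul_counitr h); move: (comul H h).
apply: tens_lin_ext => [||u v].
- apply: (@lin_comp _ _ _ _ (tcontr _)); first exact: tcontr_linear.
  exact: tmap_linear.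
- apply: (@lin_comp _ _ _ _ (Xvar i)) => //; exact: tcontr_linear.
by rewrite tmap_tens // !tcontr_tens (linZ lX).
Qed.

Definition talg : comodAlg H := ComodAlg talg_coactA talg_coact_counit.

Definition polyId (A : comodAlg H) : set talg :=
  [set P | forall mu : comodAlgHom talg A, mu P = 0].

End TensorAlgebraOfH.

Fixpoint qbin (k : fieldType) (q : k) (m i : nat) : k :=
  match m, i with
  | _, 0%N => 1
  | 0%N, _.+1 => 0
  | m.+1, i.+1 => qbin q m i + q ^+ i.+1 * qbin q m i.+1
  end.

Section QBinomial.
Variables (k : fieldType) (q : k).

Lemma qbin0 m : qbin q m 0 = 1. Proof. by case: m. Qed.

Lemma qbin_small m i : (m < i)%N -> qbin q m i = 0.
Proof.
elim: m i => [|m IH] [|i] //= lt_mi.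
by rewrite (IH i) // (IH i.+1) ?mulr0 ?addr0 // ltnW.
Qed.

Lemma qbin_diag m : qbin q m m = 1.
Proof. by elim: m => //= m ->; rewrite qbin_small // mulr0 addr0. Qed.

Lemma qbin_step m j : (j <= m)%N ->
  (1 - q ^+ (m - j)) * qbin q m j = (1 - q ^+ j.+1) * qbin q m j.+1.
Proof.
elim: m j => [|m IH] j.
  by rewrite leqn0 => /eqP-> /=; rewrite subnn expr0 subrr mul0r mulr0.
have expE i : (i <= m)%N -> q ^+ m.+1 = q ^+ i.+1 * q ^+ (m - i).
  by move=> le_im; rewrite -exprD addSn subnKC.
have absorb i : (i <= m)%N ->
    (1 - q ^+ i.+1) * qbin q m.+1 i.+1 = (1 - q ^+ m.+1) * qbin q m i.
  by move=> le_im /=; rewrite mulrDr mulrCA -IH // (expE i le_im); ring.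
rewrite leq_eqVlt => /orP[/eqP->|le_jm].
  by rewrite subnn expr0 subrr mul0r qbin_small // mulr0.
rewrite absorb //; case: j le_jm => [|j] le_jm; first by rewrite subn0 !qbin0.
have le_jm' : (j <= m)%N by exact: ltnW.
by rewrite subSS /= mulrDr IH // (expE j le_jm'); ring.
Qed.

Lemma qbin_prim n i : n.-primitive_root q -> (0 < i < n)%N -> qbin q n i = 0.
Proof.
case: n => [|n] qn; first by rewrite ltn0 andbF.
case: i => // i /andP[_ lt_in]; have le_in : (i <= n)%N by exact: ltnW.
have h : (1 - q ^+ i.+1) * qbin q n.+1 i.+1 = 0.
  rewrite /= mulrDr mulrCA -qbin_step //.
  have e : q ^+ i.+1 * q ^+ (n - i) = 1.
    by rewrite -exprD addSn subnKC // (prim_expr_order qn).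
  have -> : (1 - q ^+ i.+1) * qbin q n i +
    q ^+ i.+1 * ((1 - q ^+ (n - i)) * qbin q n i) =
    (1 - q ^+ i.+1 * q ^+ (n - i)) * qbin q n i by ring.
  by rewrite e subrr mul0r.
move/eqP: h; rewrite mulf_eq0 => /orP[|/eqP //].
rewrite subr_eq0 eq_sym -(prim_order_dvd qn) => dv.
by have := dvdn_leq (ltn0Sn i) dv; rewrite leqNgt lt_in.
Qed.

Variable A : pzAlgType k.

Lemma qcomm_exp (a b : A) m : a * b = q *: (b * a) -> a * b ^+ m = q ^+ m *: (b ^+ m * a).
Proof.
move=> ab; elim: m => [|m IH]; first by rewrite !expr0 scale1r mulr1 mul1r.
rewrite exprS mulrA ab -pzscalerAl -mulrA IH -pzscalerAr mulrA -exprS scalerA.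
by rewrite -exprS.
Qed.

Lemma qbinomial (a b : A) m : a * b = q *: (b * a) ->
  (a + b) ^+ m = \sum_(i < m.+1) qbin q m i *: (b ^+ i * a ^+ (m - i)).
Proof.
move=> ab; elim: m => [|m IH].
  by rewrite big_ord_recl big_ord0 /= !expr0 mulr1 scale1r addr0.
rewrite exprS IH mulrDl !mulr_sumr.
rewrite [in RHS]big_ord_recl /= subn0 expr0 mul1r scale1r.
under [in RHS]eq_bigr => i _ do rewrite /bump /= add1n subSS scalerDl.
rewrite big_split /= [RHS]addrCA [LHS]addrC; congr (_ + _).
  by apply: eq_bigr => i _; rewrite -pzscalerAr mulrA -exprS.
rewrite big_ord_recl /= qbin0 subn0 expr0 mul1r scale1r -exprS.
rewrite [in RHS]big_ord_recr /= qbin_small // mulr0 scale0r addr0.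
congr (_ + _); apply: eq_bigr => i _; rewrite /bump /= add1n.
rewrite -pzscalerAr mulrA (qcomm_exp _ ab) -pzscalerAl scalerA mulrC.
by rewrite -mulrA -exprS -subSn ?subSS.
Qed.

Lemma qbinomial_prim (a b : A) n : n.-primitive_root q -> a * b = q *: (b * a) ->
  (a + b) ^+ n = a ^+ n + b ^+ n.
Proof.
move=> qn ab; rewrite (qbinomial _ ab).
have := prim_order_gt0 qn; case: n qn => // n qn _.
move: (qbin0 n.+1) (qbin_diag n.+1) (fun i => @qbin_prim _ i qn).
move: (qbin q n.+1) => c c0 cn ci.
rewrite big_ord_recl big_ord_recr /= c0 subn0 !expr0 mul1r scale1r.
rewrite big1 => [|i _]; last first.
  by rewrite ci ?scale0r // /bump /= add1n ltnS ltn_ord.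
by rewrite add0r /bump /= add1n subnn expr0 mulr1 cn scale1r.
Qed.

Lemma qcomm_mul_nil (a b : A) (d : k) n :
  b * a = d *: (a * b) -> a ^+ n = 0 -> (a * b) ^+ n = 0.
Proof.
move=> ba an0.
have ba_exp m : b * a ^+ m = d ^+ m *: (a ^+ m * b).
  elim: m => [|m IH]; first by rewrite !expr0 scale1r mulr1 mul1r.
  rewrite exprS mulrA ba -pzscalerAl -mulrA IH -pzscalerAr mulrA -exprS scalerA.
  by rewrite -exprS.
have [e ->] : exists e : k, (a * b) ^+ n = e *: (a ^+ n * b ^+ n).
  elim: n {an0} => [|m [e IH]]; first by exists 1; rewrite !expr0 mulr1 scale1r.
  exists (e * d ^+ m); rewrite exprS IH -pzscalerAr -scalerA; congr (_ *: _).
  by rewrite -mulrA [b * _]mulrA ba_exp -pzscalerAl -pzscalerAr !exprS !mulrA.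
by rewrite an0 mul0r scaler0.
Qed.

End QBinomial.

Record monomial_datum (k : fieldType) (n : nat) (q : k) (G : finGroupType)
    (x : G) (chi : G -> k) : Prop := MonomialDatum {
  md_prim : n.-primitive_root q;
  md_central : x \in 'Z([set: G])%g;
  md_order : #[x]%g = n;
  md_chi_neq0 : forall g, chi g != 0;
  md_chiM : forall g h, chi (g * h)%g = chi g * chi h;
  md_chiX : forall g, chi g ^+ n = 1;
  md_chix : chi x = q
}.

Record normalized_cocycle (k : fieldType) (G : finGroupType)
    (sigma : G -> G -> k) : Prop := NormalizedCocycle {
  cocycle_neq0 : forall g h, sigma g h != 0;
  cocycle_eq : forall g h l,
    sigma g h * sigma (g * h)%g l = sigma h l * sigma g (h * l)%g;
  cocycle_1l : forall g, sigma 1%g g = 1;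
  cocycle_1r : forall g, sigma g 1%g = 1
}.

Inductive typeI_gen (G : Type) : Type :=
| GenG of G
| GenY.
Arguments GenY {G}.

Notation "'u[ g ]" := (Gen (GenG g%g)) (format "''u[' g ]") : alg_term_scope.
Notation "''uy'" := (Gen GenY) : alg_term_scope.

(* With [sigma] constantly 1 and [c = 0] these are the relations of the
   monomial Hopf algebra: the first two present the group algebra kG. *)
Inductive typeI_rel (k : fieldType) (n : nat) (G : finGroupType) (chi : G -> k)
    (sigma : G -> G -> k) (c : k) :
  term k (typeI_gen G) -> term k (typeI_gen G) -> Prop :=
| typeI_one : typeI_rel n chi sigma c ('u[1])%alg 1%:C%alg
| typeI_mul g h : typeI_rel n chi sigma c
    ('u[g] * 'u[h])%alg ((sigma g h)%:C * 'u[g * h])%alg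
| typeI_exp : typeI_rel n chi sigma c ('uy ^+ n)%alg c%:C%alg
| typeI_comm g : typeI_rel n chi sigma c
    ('uy * 'u[g])%alg ((chi g)%:C * ('u[g] * 'uy))%alg.

(* A_{sigma,c}, and the case sigma = 1, c = 0 that underlies H. *)
Definition typeI_alg (k : fieldType) (n : nat) (G : finGroupType) (chi : G -> k)
    (sigma : G -> G -> k) (c : k) : pzAlgType k :=
  presAlg (typeI_rel n chi sigma c).

Definition monomial_alg (k : fieldType) (n : nat) (G : finGroupType)
    (chi : G -> k) : pzAlgType k :=
  typeI_alg n chi (fun _ _ => 1) 0.

Section OppositeAlgebra.
Variables (k : fieldType) (A : pzAlgType k).

Definition opp_mul (a b : A) : A := b * a.
Lemma opp_mulA : associative opp_mul.
Proof. by move=> a b c; rewrite /opp_mul mulrA. Qed.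
Lemma opp_mul1 : left_id (1 : A) opp_mul.
Proof. by move=> a; rewrite /opp_mul mulr1. Qed.
Lemma opp_mulr1 : right_id (1 : A) opp_mul.
Proof. by move=> a; rewrite /opp_mul mul1r. Qed.
Lemma opp_mulDl : left_distributive opp_mul +%R.
Proof. by move=> a b c; rewrite /opp_mul mulrDr. Qed.
Lemma opp_mulDr : right_distributive opp_mul +%R.
Proof. by move=> a b c; rewrite /opp_mul mulrDl. Qed.
Lemma opp_scaleAl (a : k) u v : a *: opp_mul u v = opp_mul (a *: u) v.
Proof. exact: pzscalerAr. Qed.
Lemma opp_scaleAr (a : k) u v : a *: opp_mul u v = opp_mul u (a *: v).
Proof. exact: pzscalerAl. Qed.

Definition oppAlg : pzAlgType k :=
  @PzAlg k A 1 opp_mul opp_mulA opp_mul1 opp_mulr1 opp_mulDl opp_mulDr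
    opp_scaleAl opp_scaleAr.

Lemma opp_exp (a : A) m : (a : oppAlg) ^+ m = (a ^+ m : A).
Proof. by elim: m => // m IH; rewrite exprS IH exprSr. Qed.

End OppositeAlgebra.

Section TypeI.
Variables (k : fieldType) (n : nat) (G : finGroupType) (chi : G -> k).

Section Generators.
Variables (sigma : G -> G -> k) (c : k).
Notation A := (typeI_alg n chi sigma c).

Definition ug (g : G) : A := pgen (typeI_rel n chi sigma c) (GenG g).
Definition uy : A := pgen (typeI_rel n chi sigma c) GenY.

Lemma ug1 : ug 1%g = 1.
Proof.
by have := pgen_rel (typeI_one n chi sigma c); rewrite /= scale1r.
Qed.

Lemma ugM g h : ug g * ug h = sigma g h *: ug (g * h)%g.
Proof.
have := pgen_rel (typeI_mul n chi sigma c g h).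
by rewrite /= -pzscalerAl mul1r.
Qed.

Lemma uyX : uy ^+ n = c *: (1 : A).
Proof.
by have := pgen_rel (typeI_exp n chi sigma c); rewrite term_eval_exp.
Qed.

Lemma uyg g : uy * ug g = chi g *: (ug g * uy).
Proof.
have := pgen_rel (typeI_comm n chi sigma c g).
by rewrite /= -pzscalerAl mul1r.
Qed.

Section Lift.
Variables (B : pzAlgType k) (e : G -> B) (y : B).
Hypotheses (e1 : e 1%g = 1)
  (eM : forall g h, e g * e h = sigma g h *: e (g * h)%g)
  (yX : y ^+ n = c *: (1 : B))
  (ye : forall g, y * e g = chi g *: (e g * y)).

Definition typeI_lift_gen (i : typeI_gen G) : B :=
  match i with GenG g => e g | GenY => y end.

Lemma typeI_lift_rel s t : typeI_rel n chi sigma c s t ->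
  term_eval typeI_lift_gen s = term_eval typeI_lift_gen t.
Proof.
case=> [|g h||g] /=.
- by rewrite e1 scale1r.
- by rewrite eM -pzscalerAl mul1r.
- by rewrite term_eval_exp.
- by rewrite ye -pzscalerAl mul1r.
Qed.

Definition typeI_lift : algHom A B := pres_lift typeI_lift_rel.

Lemma typeI_lift_ug g : typeI_lift (ug g) = e g.
Proof. exact: (pres_lift_gen typeI_lift_rel). Qed.

Lemma typeI_lift_uy : typeI_lift uy = y.
Proof. exact: (pres_lift_gen typeI_lift_rel). Qed.

End Lift.

Lemma typeI_hom_ext (B : pzAlgType k) (f g : algHom A B) :
  (forall h, f (ug h) = g (ug h)) -> f uy = g uy -> forall a, f a = g a.
Proof. by move=> fg fy; apply: pres_hom_ext => -[h|]; [exact: fg | exact: fy]. Qed.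

Lemma typeI_ind (P : A -> Prop) :
  (forall g, P (ug g)) -> P uy -> (forall a : k, P (a *: (1 : A))) ->
  (forall u v, P u -> P v -> P (u + v)) ->
  (forall u v, P u -> P v -> P (u * v)) -> forall a, P a.
Proof.
move=> Pg Py Pc Pa Pm; elim/pres_ind => t; rewrite pres_pi_eval.
elim: t => [[g|]|b|s IHs t IHt|s IHs t IHt] /=.
- exact: Pg.
- exact: Py.
- exact: Pc.
- exact: Pa.
- exact: Pm.
Qed.

End Generators.

Notation H := (monomial_alg n chi).
Notation hg := (ug (fun _ _ => 1) 0 : G -> H).
Notation hy := (uy (fun _ _ => 1) 0 : H).

Lemma hgM g h : hg g * hg h = hg (g * h)%g.
Proof. by rewrite ugM scale1r. Qed.

Lemma hgX g m : hg g ^+ m = hg (g ^+ m)%g.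
Proof.
elim: m => [|m IH]; first by rewrite expr0 expg0 ug1.
by rewrite exprS IH hgM expgS.
Qed.

Lemma hyX : hy ^+ n = 0.
Proof. by rewrite uyX scale0r. Qed.

Variables (q : k) (x : G).
Hypothesis D : monomial_datum n q x chi.

Lemma chi1 : chi 1%g = 1.
Proof.
apply: (mulfI (md_chi_neq0 D 1%g)).
by rewrite -(md_chiM D) mulg1 mulr1.
Qed.

Lemma chiV g : chi g * chi g^-1%g = 1.
Proof. by rewrite -(md_chiM D) mulgV chi1. Qed.

Lemma xC g : (x * g)%g = (g * x)%g.
Proof. by have /centerP[_ /(_ g (finset.in_setT g))] := md_central D. Qed.

Lemma hgxX : hg x ^+ n = 1.
Proof.
have xn : (x ^+ n = 1)%g by rewrite -(md_order D) expg_order.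
by rewrite hgX xn ug1.
Qed.

Section Coaction.
Variables (sigma : G -> G -> k) (c : k).
Notation A := (typeI_alg n chi sigma c).
Notation ag := (ug sigma c : G -> A).
Notation ay := (uy sigma c : A).

Definition dg (g : G) : tensorAlg A H := ag g ⊗ hg g.
Definition dy : tensorAlg A H := (1 : A) ⊗ hy + ay ⊗ hg x.

Lemma dg1 : dg 1%g = 1.
Proof. by rewrite /dg !ug1. Qed.

Lemma dgM g h : dg g * dg h = sigma g h *: dg (g * h)%g.
Proof. by rewrite /dg tensM ugM hgM tensZl. Qed.

Lemma dyX : dy ^+ n = c *: (1 : tensorAlg A H).
Proof.
rewrite /dy (qbinomial_prim (md_prim D)); last first.
  by rewrite !tensM mul1r mulr1 uyg tensZr (md_chix D).
by rewrite !tensX hyX tens0r add0r uyX hgxX tensZl.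
Qed.

Lemma dyg g : dy * dg g = chi g *: (dg g * dy).
Proof.
rewrite /dy /dg mulrDl mulrDr !tensM mul1r mulr1 !uyg !hgM xC.
by rewrite tensZl tensZr scalerDr.
Qed.

Definition typeI_coact : algHom A (tensorAlg A H) := typeI_lift dg1 dgM dyX dyg.

Lemma typeI_coact_ug g : typeI_coact (ag g) = ag g ⊗ hg g.
Proof. exact: typeI_lift_ug. Qed.

Lemma typeI_coact_uy : typeI_coact ay = (1 : A) ⊗ hy + ay ⊗ hg x.
Proof. exact: typeI_lift_uy. Qed.

End Coaction.

Definition monomial_comul : algHom H (tensorAlg H H) :=
  typeI_coact (fun _ _ => 1) 0.

Lemma eps1 : (fun _ : G => 1 : regAlg k) 1%g = 1. Proof. by []. Qed.
Lemma epsM (g h : G) : (1 : regAlg k) * 1 = (1 : k) *: (1 : regAlg k).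
Proof. by rewrite scale1r mulr1. Qed.
Lemma epsX : (0 : regAlg k) ^+ n = (0 : k) *: (1 : regAlg k).
Proof.
by rewrite scale0r; have := prim_order_gt0 (md_prim D); case: n => // m _; rewrite exprS mul0r.
Qed.
Lemma epsC (g : G) : (0 : regAlg k) * 1 = chi g *: ((1 : regAlg k) * 0).
Proof. by rewrite mul0r mulr0 scaler0. Qed.

Definition monomial_counit : algHom H (regAlg k) :=
  typeI_lift eps1 epsM epsX epsC.

Lemma monomial_counit_hg g : monomial_counit (hg g) = 1.
Proof. exact: (typeI_lift_ug eps1 epsM epsX epsC). Qed.

Lemma monomial_counit_hy : monomial_counit hy = 0.
Proof. exact: (typeI_lift_uy eps1 epsM epsX epsC). Qed.

Section ComoduleAxioms.
Variables (sigma : G -> G -> k) (c : k).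
Notation A := (typeI_alg n chi sigma c).
Notation ag := (ug sigma c : G -> A).
Notation ay := (uy sigma c : A).
Notation delta := (typeI_coact sigma c).

Lemma typeI_coactA a : tassoc (tmap delta (@id H) (delta a)) =
  tmap (@id A) monomial_comul (delta a).
Proof.
pose f := alg_comp (tassoc_alg _ _ _)
  (alg_comp (tmap_alg delta (alg_id H)) delta).
pose g := alg_comp (tmap_alg (alg_id A) monomial_comul) delta.
have ld := algHom_linear delta; have lD := algHom_linear monomial_comul.
have l1 := tmap_linear ld (@lin_id _ H).
have l2 := tmap_linear (@lin_id _ A) lD.
have lt := @tassoc_linear k A H H.
apply: (@typeI_hom_ext _ _ _ f g) => [h|].
  change (tassoc (tmap delta (@id H) (delta (ag h))) =
    tmap (@id A) monomial_comul (delta (ag h))).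
  rewrite typeI_coact_ug !tmap_tens //.
  by rewrite typeI_coact_ug [monomial_comul _]typeI_coact_ug tassoc_tens.
change (tassoc (tmap delta (@id H) (delta ay)) =
  tmap (@id A) monomial_comul (delta ay)).
rewrite typeI_coact_uy (linD l1) (linD l2) !tmap_tens //.
rewrite (algHom_one delta) typeI_coact_uy [monomial_comul hy]typeI_coact_uy.
rewrite [monomial_comul (hg x)]typeI_coact_ug tensDl tensDr !(linD lt).
by rewrite !tassoc_tens addrA.
Qed.

Lemma typeI_coact_counit a : tcontr monomial_counit (delta a) = a.
Proof.
pose f := alg_comp (tcontr_alg A monomial_counit) delta.
have lt := @tcontr_linear k A H monomial_counit.
apply: (@typeI_hom_ext _ _ _ f (alg_id _)) => [h|].
  change (tcontr monomial_counit (delta (ag h)) = ag h).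
  by rewrite typeI_coact_ug tcontr_tens monomial_counit_hg scale1r.
change (tcontr monomial_counit (delta ay) = ay).
rewrite typeI_coact_uy (linD lt) !tcontr_tens monomial_counit_hy.
by rewrite monomial_counit_hg scale0r scale1r add0r.
Qed.

End ComoduleAxioms.

Lemma monomial_comul_counitl h : tcontl monomial_counit (monomial_comul h) = h.
Proof.
pose f := alg_comp (tcontl_alg H monomial_counit) monomial_comul.
have lt := @tcontl_linear k H H monomial_counit.
apply: (@typeI_hom_ext _ _ _ f (alg_id _)) => [g|].
  change (tcontl monomial_counit (monomial_comul (hg g)) = hg g).
  rewrite [monomial_comul _]typeI_coact_ug tcontl_tens.
  by rewrite monomial_counit_hg scale1r.
change (tcontl monomial_counit (monomial_comul hy) = hy).
rewrite [monomial_comul _]typeI_coact_uy (linD lt) !tcontl_tens.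
by rewrite algHom_one monomial_counit_hy scale0r scale1r addr0.
Qed.

Definition Sg (g : G) : oppAlg H := hg g^-1%g.
Definition Sy : oppAlg H := - (hy * hg x^-1%g).

Lemma Sg1 : Sg 1%g = 1.
Proof. by rewrite /Sg invg1 ug1. Qed.

Lemma SgM g h : Sg g * Sg h = (1 : k) *: Sg (g * h)%g.
Proof. by rewrite scale1r /Sg invMg -hgM. Qed.

Lemma SyX : Sy ^+ n = (0 : k) *: (1 : oppAlg H).
Proof.
rewrite scale0r opp_exp exprNn.
rewrite (qcomm_mul_nil (d := chi x)) ?mulr0 ?hyX //.
by rewrite uyg scalerA chiV scale1r.
Qed.

Lemma SyC g : Sy * Sg g = chi g *: (Sg g * Sy).
Proof.
change (hg g^-1%g * - (hy * hg x^-1%g) =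
  chi g *: (- (hy * hg x^-1%g) * hg g^-1%g)).
have xgV : (x^-1 * g^-1 = g^-1 * x^-1)%g by rewrite -!invMg xC.
rewrite mulrN mulNr scalerN; congr (- _).
rewrite -[in RHS]mulrA [in RHS]hgM xgV -[in RHS]hgM ![in RHS]mulrA [in RHS]uyg.
by rewrite -pzscalerAl scalerA chiV scale1r mulrA.
Qed.

Definition monomial_antipode : H -> H := typeI_lift Sg1 SgM SyX SyC.

Lemma monomial_antipode_linear : linear monomial_antipode.
Proof. exact: algHom_linear (typeI_lift Sg1 SgM SyX SyC). Qed.

Lemma monomial_antipodeM u v :
  monomial_antipode (u * v) = monomial_antipode v * monomial_antipode u.
Proof. exact: algHom_mul (typeI_lift Sg1 SgM SyX SyC) u v. Qed.

Lemma monomial_antipode1 : monomial_antipode 1 = 1.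
Proof. exact: algHom_one (typeI_lift Sg1 SgM SyX SyC). Qed.

Lemma monomial_antipode_hg g : monomial_antipode (hg g) = hg g^-1%g.
Proof. exact: (typeI_lift_ug Sg1 SgM SyX SyC). Qed.

Lemma monomial_antipode_hy : monomial_antipode hy = - (hy * hg x^-1%g).
Proof. exact: (typeI_lift_uy Sg1 SgM SyX SyC). Qed.

Notation S := monomial_antipode.
Notation eps := monomial_counit.

Lemma convl_bilin : bilin (fun a b : H => S a * b).
Proof.
split=> [a|b] c u v; first exact: alg_mul_linr.
by rewrite monomial_antipode_linear mulr_linear.
Qed.

Lemma convr_bilin : bilin (fun a b : H => a * S b).
Proof.
split=> [a|b] c u v; last exact: mulr_linear.
by rewrite monomial_antipode_linear alg_mul_linr.
Qed.

Lemma monomial_antipodel h :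
  tlift (fun a b : H => S a * b) (monomial_comul h) = (eps h : k) *: (1 : H).
Proof.
have lc := tlift_linear convl_bilin.
elim/typeI_ind: h => [g||a|u v IHu IHv|u v IHu IHv].
- rewrite [monomial_comul _]typeI_coact_ug tlift_tens; last exact: convl_bilin.
  by rewrite monomial_antipode_hg hgM mulVg monomial_counit_hg scale1r ug1.
- rewrite [monomial_comul _]typeI_coact_uy (linD lc).
  rewrite !tlift_tens; do ?exact: convl_bilin.
  rewrite monomial_antipode1 mul1r monomial_antipode_hy mulNr -mulrA hgM mulVg.
  by rewrite ug1 mulr1 subrr monomial_counit_hy scale0r.
- rewrite !alg_scal1 (linZ lc) tlift_tens; last exact: convl_bilin.
  by rewrite monomial_antipode1 mulr1 /GRing.scale /= mulr1.
- by rewrite !(linD (algHom_linear _)) (linD lc) IHu IHv -scalerDl.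
rewrite !algHom_mul.
have key (s t : tensorAlg H H) (b : k) :
    tlift (fun a b : H => S a * b) s = b *: (1 : H) ->
    tlift (fun a b : H => S a * b) (s * t) =
    b *: tlift (fun a b : H => S a * b) t.
  move=> es; move: t; apply: tens_lin_ext.
  - by move=> d t t'; rewrite alg_mul_linr lc.
  - move=> d t t'; rewrite lc scalerDr !scalerA; congr (_ *: _ + _).
    exact: mulrC.
  move=> v' w'; rewrite tlift_tens; last exact: convl_bilin.
  transitivity (S v' * tlift (fun a b : H => S a * b) s * w'); last first.
    by rewrite es -pzscalerAr mulr1 -pzscalerAl.
  move: s {es}; apply: tens_lin_ext.
  - by move=> d t t'; rewrite mulr_linear lc.
  - by move=> d t t'; rewrite lc alg_mul_linr mulr_linear.
  move=> a a'; rewrite tensM !tlift_tens; do ?exact: convl_bilin.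
  by rewrite monomial_antipodeM !mulrA.
by rewrite (key _ _ _ IHu) IHv scalerA.
Qed.

Lemma monomial_antipoder h :
  tlift (fun a b : H => a * S b) (monomial_comul h) = (eps h : k) *: (1 : H).
Proof.
have lc := tlift_linear convr_bilin.
elim/typeI_ind: h => [g||a|u v IHu IHv|u v IHu IHv].
- rewrite [monomial_comul _]typeI_coact_ug tlift_tens; last exact: convr_bilin.
  by rewrite monomial_antipode_hg hgM mulgV monomial_counit_hg scale1r ug1.
- rewrite [monomial_comul _]typeI_coact_uy (linD lc).
  rewrite !tlift_tens; do ?exact: convr_bilin.
  rewrite monomial_antipode_hg mul1r monomial_antipode_hy addNr.
  by rewrite monomial_counit_hy scale0r.
- rewrite !alg_scal1 (linZ lc) tlift_tens; last exact: convr_bilin.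
  by rewrite monomial_antipode1 mulr1 /GRing.scale /= mulr1.
- by rewrite !(linD (algHom_linear _)) (linD lc) IHu IHv -scalerDl.
rewrite !algHom_mul.
have key (s t : tensorAlg H H) (b : k) :
    tlift (fun a b : H => a * S b) t = b *: (1 : H) ->
    tlift (fun a b : H => a * S b) (s * t) =
    b *: tlift (fun a b : H => a * S b) s.
  move=> et; move: s; apply: tens_lin_ext.
  - by move=> d s s'; rewrite mulr_linear lc.
  - move=> d s s'; rewrite lc scalerDr !scalerA; congr (_ *: _ + _).
    exact: mulrC.
  move=> v' w'; rewrite tlift_tens; last exact: convr_bilin.
  transitivity (v' * tlift (fun a b : H => a * S b) t * S w'); last first.
    by rewrite et -pzscalerAr mulr1 -pzscalerAl.
  move: t {et}; apply: tens_lin_ext.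
  - by move=> d t t'; rewrite alg_mul_linr lc.
  - by move=> d t t'; rewrite lc alg_mul_linr mulr_linear.
  move=> a a'; rewrite tensM !tlift_tens; do ?exact: convr_bilin.
  by rewrite monomial_antipodeM !mulrA.
by rewrite (key _ _ _ IHv) IHu scalerA mulrC.
Qed.

Definition monomialHopf : hopfAlg k :=
  @HopfAlg k H monomial_comul monomial_counit monomial_antipode
    (@typeI_coactA (fun _ _ => 1) 0) monomial_comul_counitl
    (@typeI_coact_counit (fun _ _ => 1) 0)
    monomial_antipode_linear monomial_antipodel monomial_antipoder.

Definition typeI_comodAlg (sigma : G -> G -> k) (c : k) : comodAlg monomialHopf :=
  @ComodAlg k monomialHopf (typeI_alg n chi sigma c) (typeI_coact sigma c)
    (@typeI_coactA sigma c) (@typeI_coact_counit sigma c).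

End TypeI.

(* Main.v *)
Require Import Defs.
From HB Require Import structures.
From mathcomp Require Import all_boot all_order all_algebra all_fingroup all_solvable.
From mathcomp Require Import boolp classical_sets.
From mathcomp Require Import ring.

(** Write A for A_{sigma,c}, with generators u_g and u_y, and A' for
    A_{sigma',c'}.  The monomials u_g u_y^i with i < n form a basis of A
    ([coordsK], [coords_mon]), and matching the bases of A and of H identifies
    the comodule A with H, whatever sigma and c are ([relabel_colinear]).  The
    identification has two uses.

    On the one hand it bounds the images of the variables under a comodule
    algebra map mu : T -> A.  In H the counit shows that an element with
    coaction a |-> a ⊗ g is a multiple of g, hence mu(X^g) = t_g u_g, and it
    follows that mu(X^1) = e and mu(X^y) = e u_y + r u_x for scalars e and r
    ([hom_grouplike], [hom_skew_primitive]).  On the other hand it is itself a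
    colinear map H -> A, so that some mu has mu(X^g) = u_g and mu(X^y) = u_y
    ([exists_hom]).  An identity of A is therefore checked on the first form
    and exploited, once it is known to hold in A', on the second map.

    Equality of the parameters.  As u_y u_x = q u_x u_y with q a primitive n-th
    root of unity, the q-binomial formula gives
    (e u_y + r u_x)^n = e^n c + r^n u_x^n, while
    X^y X^x - q X^x X^y is sent to (1 - q) r t_x u_x^2.  Eliminating r leaves
    the identity
      (1-q)^n (X^y)^n (X^x)^n - (X^y X^x - q X^x X^y)^n
        = (1-q)^n c (X^1)^n (X^x)^n,
    in which c is visible ([power_poly_id], [power_poly_inv]).

    Equality of the classes of the cocycles.  If w and w' are words in G with
    the same letters and the same product, then u_w and u_w' are multiples of
    one another, and the ratio is read off an identity: the scalars t_g cancel
    ([word_swap_id], [word_swap_inv]).  So tau = sigma / sigma' gives the same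
    weight to w and to w'.  The unknowns lambda(g) of the equations
    lambda(g) lambda(h) = tau(g,h) lambda(gh) can then be found: an integer
    relation between the rows g + h - gh of this multiplicative system amounts
    to a pair of such words, so the right-hand sides are compatible with all
    relations between rows, and over an algebraically closed field the Smith
    normal form solves every compatible system ([exp_system_solve],
    [coboundary_of_words]).  Then u_g |-> lambda(g) u'_g, u_y |-> u'_y is an
    isomorphism ([cohomologous_iso]). *)

Set Implicit Arguments.
Unset Strict Implicit.
Unset Printing Implicit Defensive.

Import GRing.Theory.
Local Open Scope ring_scope.

(** * Multiplicative systems of equations with integer exponents *)

Lemma exists_int_root (k : closedFieldType) (a : k) (d : int) :
  a != 0 -> d != 0 -> exists2 b : k, b != 0 & b ^ d = a.
Proof.
move=> a0 d0.
have rootn (m : nat) (b : k) : (0 < m)%N -> b != 0 ->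
    exists2 e : k, e != 0 & e ^+ m = b.
  move=> m0 b0; have [e e_root] := solve_monicpoly (nth 0 [:: b]) m0.
  have em : e ^+ m = b.
    rewrite e_root; clear e_root; case: m m0 => [|m] // _.
    rewrite big_ord_recl /= expr0 mulr1 big1 ?addr0 // => i _.
    by rewrite nth_nil mul0r.
  exists e => //; apply: contraNneq b0 => e0.
  by rewrite -em e0 expr0n eqn0Ngt m0.
case: d d0 => m d0; first by apply: (rootn m) => //; rewrite lt0n.
have [|e e0 em] := rootn m.+1 a^-1 isT; first by rewrite invr_neq0.
by exists e => //; rewrite NegzE -exprnN em invrK.
Qed.

Section MultiplicativeSystem.
Variable k : fieldType.

(** The multiplicative action of integer matrices on tuples of units: the
    column [t] written additively is sent to [A *m t]. *)
Definition mxexp m n (A : 'M[int]_(m, n)) (t : 'I_n -> k) (i : 'I_m) : k :=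
  \prod_j t j ^ A i j.

Lemma mxexp_neq0 m n (A : 'M[int]_(m, n)) t :
  (forall j, t j != 0) -> forall i, mxexp A t i != 0.
Proof. by move=> t0 i; apply/prodf_neq0 => j _; rewrite expfz_neq0. Qed.

Lemma mxexp_ext m n (A : 'M[int]_(m, n)) s t : s =1 t -> mxexp A s =1 mxexp A t.
Proof. by move=> st i; apply: eq_bigr => j _; rewrite st. Qed.

Lemma expfz_suml (I : Type) (r : seq I) (a : k) (F : I -> int) : a != 0 ->
  a ^ (\sum_(i <- r) F i) = \prod_(i <- r) a ^ F i.
Proof.
move=> a0; elim: r => [|i r IH]; first by rewrite !big_nil.
by rewrite !big_cons expfzDr // IH.
Qed.

Lemma expfz_prodl (I : Type) (r : seq I) (F : I -> k) (z : int) :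
  (\prod_(i <- r) F i) ^ z = \prod_(i <- r) F i ^ z.
Proof.
elim: r => [|i r IH]; first by rewrite !big_nil exp1rz.
by rewrite !big_cons expfzMl IH.
Qed.

Lemma mxexpM m n p (A : 'M[int]_(m, n)) (B : 'M[int]_(n, p)) t :
  (forall j, t j != 0) -> mxexp (A *m B) t =1 mxexp A (mxexp B t).
Proof.
move=> t0 i; rewrite /mxexp.
under [RHS]eq_bigr do rewrite expfz_prodl.
rewrite exchange_big; apply: eq_bigr => j _.
rewrite mxE expfz_suml //; apply: eq_bigr => l _.
by rewrite exprz_exp mulrC.
Qed.

Lemma mxexp1 n (t : 'I_n -> k) : mxexp 1%:M t =1 t.
Proof.
move=> i; rewrite /mxexp (bigD1 i) //= mxE eqxx expr1z big1 ?mulr1 // => j ji.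
by rewrite mxE eq_sym (negbTE ji) expr0z.
Qed.

End MultiplicativeSystem.

(** In Smith form M = L D R the system becomes diagonal after a unimodular change
    of unknowns (R) and of equations (L).  A nonzero diagonal entry is solved by
    a root; a zero row asks for a trivial right-hand side, which is the
    compatibility condition for the corresponding row of L^-1. *)
Lemma mxexp_solve (k : closedFieldType) m n (M : 'M[int]_(m, n)) (t : 'I_m -> k) :
  (forall i, t i != 0) ->
  (forall v : 'rV[int]_m, v *m M = 0 -> \prod_i t i ^ v 0 i = 1) ->
  exists2 s : 'I_n -> k, (forall j, s j != 0) & mxexp M s =1 t.
Proof.
move=> t0 compat; have [L uL [R uR [d _ defM]]] := int_Smith_normal_form M.
set D := (\matrix_(i, j) _) in defM.
have D_entry (i : 'I_m) (j : 'I_n) : D i j = d`_i *+ (i == j :> nat) by rewrite mxE.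
pose t' := mxexp (invmx L) t.
have t'0 i : t' i != 0 by exact: mxexp_neq0.
have t'1 i : (forall j, D i j = 0) -> t' i = 1.
  move=> Di; rewrite /t' /mxexp; have := compat (row i (invmx L)).
  under eq_bigr do rewrite mxE; apply.
  rewrite -row_mul defM -mulmxA mulmxA mulVmx // mul1mx row_mul.
  suff -> : row i D = 0 by rewrite mul0mx.
  by apply/rowP => j; rewrite !mxE -D_entry Di.
have root_j (j : 'I_n) : exists s : k, (s != 0) /\
    (forall i : 'I_m, i = j :> nat -> D i j != 0 -> s ^ D i j = t' i).
  have [jm|mj] := ltnP j m; last first.
    by exists 1; split=> [|i ij]; [exact: oner_neq0 | rewrite -ij leqNgt ltn_ord in mj].
  pose i0 := Ordinal jm.
  have [D0|D0] := eqVneq (D i0 j) 0.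
    exists 1; split=> [|i ij]; first exact: oner_neq0.
    by rewrite (_ : i = i0) ?D0 ?eqxx //; apply: val_inj.
  have [s s0 ss] := exists_int_root (t'0 i0) D0.
  by exists s; split=> // i ij _; rewrite (_ : i = i0) //; apply: val_inj.
have {root_j}[s' s'P] := choice root_j.
have s'0 j : s' j != 0 by have [] := s'P j.
exists (mxexp (invmx R) s') => [|i]; first exact: mxexp_neq0.
have Ds' : mxexp D s' =1 t'.
  move=> {}i; have [Di|/forallPn/= [j Dij]] :=
    altP (@forallP _ (fun j => D i j == 0)).
    rewrite t'1 => [|j]; last exact/eqP.
    by rewrite /mxexp big1 // => j _; rewrite (eqP (Di j)) expr0z.
  have ij : i = j :> nat.
    by apply/eqP; apply: contraNT Dij => /negbTE ij; rewrite D_entry ij mulr0n.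
  rewrite /mxexp (bigD1 j) //= (proj2 (s'P j)) // big1 ?mulr1 // => l lj.
  by rewrite D_entry ij (inj_eq val_inj) eq_sym (negbTE lj) mulr0n expr0z.
have sR0 := mxexp_neq0 (invmx R) s'0.
rewrite defM -mulmxA mxexpM //.
have -> : mxexp L (mxexp (D *m R) (mxexp (invmx R) s')) i =
    mxexp L t' i.
  apply: mxexp_ext => l; rewrite -mxexpM // -mulmxA mulmxV // mulmx1.
  exact: Ds'.
by rewrite -mxexpM // mulmxV // mxexp1.
Qed.

Lemma exp_system_solve (k : closedFieldType) (I J : finType) (r : I -> J -> int)
    (t : I -> k) :
  (forall i, t i != 0) ->
  (forall v : I -> int, (forall j, \sum_i v i * r i j = 0) -> \prod_i t i ^ v i = 1) ->
  exists2 s : J -> k, (forall j, s j != 0) & forall i, \prod_j s j ^ r i j = t i.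
Proof.
move=> t0 compat.
pose M := \matrix_(a < #|I|, b < #|J|) r (enum_val a) (enum_val b).
have [|v vM|s s0 ss] := @mxexp_solve k _ _ M (t \o enum_val).
- by move=> i; exact: t0.
- have := compat (fun i => v 0 (enum_rank i)).
  rewrite (reindex_onto enum_val enum_rank) => [|i _]; last exact: enum_rankK.
  under eq_bigl do rewrite enum_valK eqxx.
  under eq_bigr do rewrite enum_valK.
  apply=> j; have := congr1 (fun u : 'rV_ _ => u 0 (enum_rank j)) vM.
  rewrite mxE [RHS]mxE => vM_j; rewrite -[RHS]vM_j.
  rewrite (reindex_onto enum_val enum_rank) => [|i _]; last exact: enum_rankK.
  under eq_bigl do rewrite enum_valK eqxx.
  by apply: eq_bigr => i _; rewrite enum_valK mxE enum_rankK.
exists (s \o enum_rank) => [j|i] /=; first exact: s0.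
have := ss (enum_rank i); rewrite /= enum_rankK => <-.
rewrite /mxexp (reindex_onto enum_val enum_rank) => [|j _]; last exact: enum_rankK.
under eq_bigl do rewrite enum_valK eqxx.
by apply: eq_bigr => j _; rewrite enum_valK mxE enum_rankK.
Qed.

(** * Weights of words and coboundaries *)

Local Notation wprod w := (\prod_(g <- w) g)%g.

Section WordWeights.
Variables (k : fieldType) (G : finGroupType) (tau : G -> G -> k).
Hypothesis tauP : normalized_cocycle tau.
Implicit Type w : seq G.

(** The scalar by which the product of the u_g along [w], in a twisted group
    algebra with cocycle [tau], differs from u of the product. *)
Fixpoint wt w : k := if w is g :: w' then tau g (wprod w') * wt w' else 1.

Lemma wt_neq0 w : wt w != 0.
Proof.
elim: w => [|g w IH] /=; first exact: oner_neq0.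
by rewrite mulf_neq0 // (cocycle_neq0 tauP).
Qed.

Lemma wt_cat w1 w2 :
  wt (w1 ++ w2) = wt w1 * wt w2 * tau (wprod w1) (wprod w2).
Proof.
elim: w1 => [|g w1 IH] /=; first by rewrite big_nil (cocycle_1l tauP) mul1r mulr1.
rewrite IH big_cat big_cons /=.
transitivity (tau (wprod w1) (wprod w2) * tau g (wprod w1 * wprod w2)%g *
  (wt w1 * wt w2)); first by ring.
by rewrite -(cocycle_eq tauP); ring.
Qed.

Lemma wt_flatten ws : wt (flatten ws) =
  (\prod_(w <- ws) wt w) * wt [seq wprod w | w <- ws].
Proof.
elim: ws => [|w ws IH] /=; first by rewrite big_nil mulr1.
rewrite wt_cat IH big_cons /=.
have -> : wprod (flatten ws) = wprod [seq wprod w | w <- ws].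
  by rewrite big_flatten big_map.
by ring.
Qed.

End WordWeights.

(** The hypothesis says that the weight of a word depends only on its product and
    on its image in the free abelian group on G.  Given a relation
    sum_p v_p (g_p + h_p - g_p h_p) = 0, take for each pair p = (g, h) |v_p|
    copies of the block gh in one word and of the block g, h in the other, the
    sign of v_p deciding which is where.  The relation makes these two words
    permutations of each other; they have the same products blockwise; and
    their weights have the ratio prod_p tau(p)^v_p, which is thus 1. *)
Lemma coboundary_of_words (k : closedFieldType) (G : finGroupType) (tau : G -> G -> k) :
  normalized_cocycle tau ->
  (forall w w' : seq G, perm_eq w w' ->
     wprod w = wprod w' -> wt tau w = wt tau w') ->
  exists2 lam : G -> k, (forall g, lam g != 0) &
    forall g h, lam g * lam h = tau g h * lam (g * h)%g.
Proof.
move=> tauP words.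
pose r (p : G * G) (a : G) : int :=
  (p.1 == a)%:R + (p.2 == a)%:R - ((p.1 * p.2)%g == a)%:R.
have [|v vr|lam lam0 lamE] := @exp_system_solve k _ _ r (fun p => tau p.1 p.2).
- by move=> p; exact: (cocycle_neq0 tauP).
- pose long (p : G * G) := [:: p.1; p.2]; pose short (p : G * G) := [:: (p.1 * p.2)%g].
  pose m p := absz (v p).
  (* The words of index false and true get opposite choices of the block. *)
  pose side e p := (0 <= v p) (+) e.
  pose blocks (e : bool) :=
    flatten [seq nseq (m p) (if side e p then long p else short p)
            | p <- index_enum (G * G)%type].
  have prod_blocks e : [seq wprod w | w <- blocks e] =
      flatten [seq nseq (m p) (p.1 * p.2)%g | p <- index_enum (G * G)%type].
    rewrite /blocks map_flatten -map_comp; congr flatten; apply: eq_map => p /=.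
    rewrite map_nseq; congr nseq.
    by case: ifP => _; rewrite !big_cons big_nil mulg1.
  have wt_blocks e : wt tau (flatten (blocks e)) =
      (\prod_p (if side e p then tau p.1 p.2 else 1) ^+ (m p)) *
      wt tau [seq wprod w | w <- blocks e].
    rewrite (wt_flatten tauP); congr (_ * _); rewrite /blocks big_flatten big_map.
    apply: eq_bigr => p _; rewrite big_nseq iter_mulr_1; congr (_ ^+ _).
    case: ifP => _ /=; rewrite ?big_cons ?big_nil ?mulg1 ?(cocycle_1r tauP) ?mulr1 //.
  have := words (flatten (blocks false)) (flatten (blocks true)).
  rewrite !wt_blocks !prod_blocks => /(_ _ _)/(mulIf (wt_neq0 tauP _)) E.
  have {}E : \prod_p (if side false p then tau p.1 p.2 else 1) ^+ (m p) =
             \prod_p (if side true p then tau p.1 p.2 else 1) ^+ (m p).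
    apply: E.
      apply/allP => a _ /=; apply/eqP.
      have count_blocks e : count_mem a (flatten (blocks e)) =
          (\sum_p m p * count_mem a (if side e p then long p else short p))%N.
        rewrite count_flatten /blocks map_flatten -map_comp sumn_flatten -map_comp.
        rewrite sumnE big_map; apply: eq_bigr => p _ /=.
        by rewrite map_nseq sumn_nseq mulnC.
      apply/eqP; rewrite -eqz_nat -!natz -subr_eq0 !count_blocks !natr_sum -sumrB.
      rewrite -[X in _ == X](vr a); apply/eqP/eq_bigr => p _.
      rewrite !natrM -mulrBr natz /r /m /side.
      case: (v p) => z /=; rewrite ?addn0 ?natrD /=.
        by rewrite ?addn0 ?natrD.
      by rewrite NegzE ?addn0 ?natrD mulNr -mulrN opprB.
    have prod_flatten e : wprod (flatten (blocks e)) =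
        wprod [seq wprod w | w <- blocks e].
      by rewrite big_flatten big_map.
    by rewrite !prod_flatten !prod_blocks.
  have tau0 p : tau p.1 p.2 != 0 by exact: (cocycle_neq0 tauP).
  apply: (@mulIf _ (\prod_p (if side true p then tau p.1 p.2 else 1) ^+ m p)).
    apply/prodf_neq0 => p _; rewrite expf_neq0 //; case: ifP => _ //.
    exact: oner_neq0.
  rewrite mul1r -[RHS]E -big_split; apply: eq_bigr => p _ /=.
  rewrite /side /m; case: (v p) => z /=; rewrite ?expr1n ?mulr1 //.
  by rewrite NegzE -exprnN mulVf ?expr1n // expf_neq0.
exists lam => // g h; rewrite -[tau g h](lamE (g, h)).
have prod_delta a : \prod_j lam j ^ ((a == j)%:R : int) = lam a.
  rewrite (bigD1 a) //= eqxx expr1z big1 ?mulr1 // => j ja.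
  by rewrite eq_sym (negbTE ja) expr0z.
under eq_bigr do rewrite /r /= expfzDr // expfzDr // -invr_expz.
by rewrite !big_split /= prodfV !prod_delta divfK.
Qed.

(** * The monomial basis *)

Lemma pz_exprZn (k : fieldType) (A : pzAlgType k) (t : k) (a : A) m :
  (t *: a) ^+ m = t ^+ m *: a ^+ m.
Proof.
elim: m => [|m IH]; first by rewrite !expr0 scale1r.
by rewrite !exprS IH -pzscalerAl -pzscalerAr scalerA.
Qed.

Definition endAlg (k : fieldType) (V : vectType k) : pzAlgType k :=
  @PzAlg k 'End(V) \1%VF (fun f g => f \o g)%VF (@comp_lfunA k V V V V)
    (@comp_lfun1l k V V) (@comp_lfun1r k V V)
    (fun f g h => comp_lfunDl f g h) (fun f g h => comp_lfunDr f g h)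
    (fun a f g => comp_lfunZl a f g) (fun a f g => comp_lfunZr a f g).

Section EndomorphismAction.
Variables (k : fieldType) (V : vectType k).
Implicit Types f g : endAlg V.

Definition ev (f : endAlg V) (v : V) : V := (f : 'End(V)) v.

Lemma ev_linear f : linear (ev f).
Proof. by move=> a u v; rewrite /ev linearP. Qed.

Lemma ev_linearl v : linear (ev^~ v).
Proof.
by move=> a f g; rewrite /ev [LHS]add_lfunE; congr (_ + _); exact: scale_lfunE.
Qed.

Lemma evM f g v : ev (f * g) v = ev f (ev g v).
Proof. exact: comp_lfunE. Qed.

Lemma ev1 v : ev 1 v = v.
Proof. exact: id_lfunE. Qed.

Lemma evZ a f v : ev (a *: f) v = a *: ev f v.
Proof. exact: scale_lfunE. Qed.

Lemma ev_inj f g : ev f =1 ev g -> f = g.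
Proof. by move=> fg; apply/lfunP. Qed.

End EndomorphismAction.

Section FiniteBasis.
Variables (k : fieldType) (I : finType).

Definition coordSpace : vectType k := {ffun I -> k^o}.

Definition basis_ext (U : lmodType k) (b : I -> U) (v : coordSpace) : U :=
  \sum_i (v i : k) *: b i.

Definition delta (i : I) : coordSpace := [ffun j => (i == j)%:R].

Lemma basis_ext_linear U b : linear (@basis_ext U b).
Proof.
move=> a u v; rewrite /basis_ext scaler_sumr -big_split; apply: eq_bigr => i _ /=.
by rewrite !ffunE scalerDl scalerA.
Qed.

Lemma basis_ext_delta U b i : @basis_ext U b (delta i) = b i.
Proof.
rewrite /basis_ext (bigD1 i) //= ffunE eqxx scale1r big1 ?addr0 // => j ji.
by rewrite ffunE eq_sym (negbTE ji) scale0r.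
Qed.

Lemma delta_span v : basis_ext delta v = v.
Proof.
apply/ffunP => i; rewrite sum_ffunE (bigD1 i) //= !ffunE eqxx big1 => [|j ji].
  by rewrite addr0 [LHS]mulr1.
by rewrite !ffunE (negbTE ji) [LHS]mulr0.
Qed.

Lemma lin_basis_ext (U : lmodType k) (f : coordSpace -> U) : linear f ->
  forall v, f v = basis_ext (f \o delta) v.
Proof.
move=> lf v; rewrite -[in LHS](delta_span v) /basis_ext.
elim/big_rec2: _ => [|i y1 y2 _ <-]; first exact: (lin0 lf).
by rewrite lf.
Qed.

HB.instance Definition _ (U : lmodType k) (b : I -> U) :=
  GRing.isLinear.Build k coordSpace U *:%R (basis_ext b) (basis_ext_linear b).

Definition basis_end (b : I -> coordSpace) : endAlg coordSpace :=
  linfun (basis_ext b).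

Lemma basis_endE b v : ev (basis_end b) v = basis_ext b v.
Proof. exact: lfunE. Qed.

End FiniteBasis.

(** Linear independence of the monomials is proved by letting A_{sigma,c} act on
    the space V with basis G x {0, ..., n-1} as it has to act on them from the
    left. *)
Section Basis.
Variables (k : fieldType) (n : nat) (G : finGroupType) (chi : G -> k).
Variables (q : k) (x : G).
Hypothesis D : monomial_datum n q x chi.

Let n_gt0 : (0 < n)%N := prim_order_gt0 (md_prim D).
Let rem (m : nat) : 'I_n := Ordinal (ltn_pmod m n_gt0).
Let remK (i : 'I_n) : rem i = i.
Proof. by apply: val_inj; rewrite /= modn_small. Qed.

Section OneAlgebra.
Variables (sigma : G -> G -> k) (c : k).
Hypothesis hs : normalized_cocycle sigma.
Notation A := (typeI_alg n chi sigma c).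
Notation ag := (ug n chi sigma c : G -> A).
Notation ay := (uy n chi sigma c : A).
Notation V := (coordSpace k (G * 'I_n)%type).

(** E g m stands for the monomial u_g u_y^m with an arbitrary exponent m, reduced
    by u_y^n = c: with all exponents available u_y acts as a plain shift. *)
Let E (g : G) (m : nat) : V := c ^+ (m %/ n) *: delta k (g, rem m).

Let E_delta g i : E g (i : 'I_n) = delta k (g, i).
Proof. by rewrite /E divn_small // expr0 scale1r remK. Qed.

Let E_mod g m : c ^+ (m %/ n) *: E g (m %% n) = E g m.
Proof. by rewrite -[(m %% n)%N]/(nat_of_ord (rem m)) E_delta. Qed.

Let E_step g m : c ^+ (m %/ n) *: E g (m %% n)%N.+1 = E g m.+1.
Proof.
rewrite /E scalerA -exprD.
have -> : (m.+1 %/ n = m %/ n + (m %% n).+1 %/ n)%N.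
  by rewrite [in LHS](divn_eq m n) -addnS divnMDl.
congr (_ *: delta k (g, _)); apply: val_inj => /=.
by rewrite -addn1 modnDml addn1.
Qed.

Let E_period g m : E g (m + n) = c *: E g m.
Proof.
rewrite /E scalerA -exprS divnDr ?divnn ?n_gt0 ?addn1 //.
by congr (_ *: delta k (g, _)); apply: val_inj; rewrite /= modnDr.
Qed.

Let Eu (g : G) : endAlg V :=
  basis_end (fun p : G * 'I_n => sigma g p.1 *: E (g * p.1)%g p.2).
Let Ey : endAlg V :=
  basis_end (fun p : G * 'I_n => chi p.1 *: E p.1 (p.2 : nat).+1).

Let EuE g h m : ev (Eu g) (E h m) = sigma g h *: E (g * h)%g m.
Proof.
rewrite basis_endE {1}/E (linZ (basis_ext_linear _)) basis_ext_delta /=.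
by rewrite scalerA mulrC -scalerA E_mod.
Qed.

Let EyE h m : ev Ey (E h m) = chi h *: E h m.+1.
Proof.
rewrite basis_endE {1}/E (linZ (basis_ext_linear _)) basis_ext_delta /=.
by rewrite scalerA mulrC -scalerA E_step.
Qed.

Let EyX j h m : ev (Ey ^+ j) (E h m) = chi h ^+ j *: E h (m + j)%N.
Proof.
elim: j => [|j IH]; first by rewrite expr0 addn0 scale1r ev1.
by rewrite exprS evM IH (linZ (ev_linear _)) EyE scalerA -exprSr addnS.
Qed.

Let lin_ext_E (U : lmodType k) (f g : V -> U) : linear f -> linear g ->
  (forall h m, f (E h m) = g (E h m)) -> forall v, f v = g v.
Proof.
move=> lf lg fg v; rewrite (lin_basis_ext lf) (lin_basis_ext lg).
by apply: eq_bigr => -[h i] _ /=; rewrite -E_delta fg.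
Qed.

Let end_ext (f g : endAlg V) :
  (forall h m, ev f (E h m) = ev g (E h m)) -> f = g.
Proof. by move=> fg; apply/ev_inj/lin_ext_E => //; exact: ev_linear. Qed.

Let Eu1 : Eu 1%g = 1.
Proof.
by apply: end_ext => h m; rewrite EuE mul1g (cocycle_1l hs) scale1r ev1.
Qed.

Let EuM g h : Eu g * Eu h = sigma g h *: Eu (g * h)%g.
Proof.
apply: end_ext => l m; rewrite evM evZ !EuE (linZ (ev_linear _)) EuE.
by rewrite !scalerA (cocycle_eq hs) mulgA.
Qed.

Let EyXn : Ey ^+ n = c *: (1 : endAlg V).
Proof.
by apply: end_ext => h m; rewrite EyX evZ ev1 (md_chiX D) scale1r E_period.
Qed.

Let EyEu g : Ey * Eu g = chi g *: (Eu g * Ey).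
Proof.
apply: end_ext => h m; rewrite evZ !evM EuE (linZ (ev_linear Ey)).
rewrite !EyE (linZ (ev_linear _)) EuE.
by rewrite !scalerA (md_chiM D); congr (_ *: _); ring.
Qed.

Let rep : algHom A (endAlg V) := typeI_lift Eu1 EuM EyXn EyEu.
Let rep_ag g : rep (ag g) = Eu g.
Proof. exact: typeI_lift_ug. Qed.
Let rep_ay : rep ay = Ey.
Proof. exact: typeI_lift_uy. Qed.

Definition coords (a : A) : V := ev (rep a) (E 1%g 0).

Lemma coords_linear : linear coords.
Proof. by move=> a u v; rewrite /coords (algHom_linear rep) ev_linearl. Qed.

Lemma coords_mon g (i : 'I_n) : coords (ag g * ay ^+ i) = delta k (g, i).
Proof.
rewrite /coords algHom_mul alg_exp rep_ag rep_ay evM EyX (chi1 D) expr1n scale1r.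
by rewrite add0n EuE (cocycle_1r hs) scale1r mulg1 E_delta.
Qed.

Definition of_coords : V -> A := basis_ext (fun p : G * 'I_n => ag p.1 * ay ^+ p.2).

Lemma of_coords_linear : linear of_coords.
Proof. exact: basis_ext_linear. Qed.

Lemma of_coords_delta g i : of_coords (delta k (g, i)) = ag g * ay ^+ i.
Proof. exact: basis_ext_delta. Qed.

Let of_coordsE g m : of_coords (E g m) = ag g * ay ^+ m.
Proof.
rewrite /E (linZ of_coords_linear) of_coords_delta /=.
rewrite [in RHS](divn_eq m n) exprD mulnC exprM uyX pz_exprZn expr1n.
by rewrite -pzscalerAl mul1r -pzscalerAr.
Qed.

(** Linearity over A reduces [coordsK] to a single vector: the composite
    A -> V -> A is right multiplication by the image of E 1 0, which is 1. *)
Let of_coords_rep a v : of_coords (ev (rep a) v) = a * of_coords v.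
Proof.
have lo := of_coords_linear.
have lin_rep b : linear (fun v => of_coords (ev (rep b) v)).
  exact: (lin_comp lo (ev_linear _)).
have lin_mul b : linear (fun v => b * of_coords v).
  exact: (lin_comp (@mull_linear _ _ b) lo).
elim/typeI_ind: a v => [g||a|a b IHa IHb|a b IHa IHb].
- apply: lin_ext_E => // h m.
  by rewrite rep_ag EuE (linZ lo) !of_coordsE mulrA ugM -pzscalerAl.
- apply: lin_ext_E => // h m.
  rewrite rep_ay EyE (linZ lo) !of_coordsE mulrA uyg -pzscalerAl -mulrA.
  by rewrite -exprS.
- by move=> v; rewrite alg_scal1 evZ ev1 (linZ lo) -pzscalerAl mul1r.
- move=> v; rewrite (linD (algHom_linear rep)) (linD (ev_linearl v)) (linD lo).
  by rewrite IHa IHb mulrDl.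
- by move=> v; rewrite algHom_mul evM IHa IHb mulrA.
Qed.

Lemma coordsK a : of_coords (coords a) = a.
Proof. by rewrite of_coords_rep of_coordsE ug1 mul1r expr0 mulr1. Qed.

End OneAlgebra.
End Basis.

(** * The algebras A_{sigma,c} as comodules *)

Section Comparison.
Variables (k : fieldType) (n : nat) (G : finGroupType) (chi : G -> k).
Variables (q : k) (x : G).
Hypothesis D : monomial_datum n q x chi.
Local Notation A s c := (typeI_alg n chi s c).
Local Notation u s c := (ug n chi s c : G -> A s c).
Local Notation y s c := (uy n chi s c : A s c).
Local Notation H := (monomial_alg n chi).
Local Notation hg := (ug n chi (fun _ _ => 1) 0 : G -> H).
Local Notation hy := (uy n chi (fun _ _ => 1) 0 : H).

Lemma trivial_cocycle : normalized_cocycle (fun _ _ : G => 1 : k).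
Proof. by split=> // *; exact: oner_neq0. Qed.

(** The coefficients of this expansion depend neither on sigma nor on c: this is
    why all A_{sigma,c} are the same comodule. *)
Lemma typeI_coact_mon s c g i :
  typeI_coact D s c (u s c g * y s c ^+ i) =
  \sum_(j < i.+1) qbin q i j *:
    ((u s c g * y s c ^+ j) ⊗ (hg g * hg x ^+ j * hy ^+ (i - j))).
Proof.
rewrite algHom_mul alg_exp typeI_coact_ug typeI_coact_uy.
have comm : ((1 : A s c) ⊗ hy : tensorAlg (A s c) H) * (y s c ⊗ hg x) =
    q *: ((y s c ⊗ hg x : tensorAlg (A s c) H) * ((1 : A s c) ⊗ hy)).
  by rewrite !tensM mul1r mulr1 uyg tensZr (md_chix D).
rewrite (qbinomial _ comm) mulr_sumr; apply: eq_bigr => j _.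
by rewrite !tensX expr1n -pzscalerAr !tensM mulr1 mulrA.
Qed.

Section Two.
Variables (s s' : G -> G -> k) (c c' : k).
Hypothesis hs : normalized_cocycle s.

Definition relabel (a : A s c) : A s' c' := of_coords chi s' c' (coords D hs a).

Lemma relabel_linear : linear relabel.
Proof. exact: (lin_comp (@of_coords_linear _ _ _ _ _ _) (coords_linear D hs)). Qed.

Lemma relabel_mon g i : (i < n)%N ->
  relabel (u s c g * y s c ^+ i) = u s' c' g * y s' c' ^+ i.
Proof.
move=> lt_in; rewrite -[i]/(nat_of_ord (Ordinal lt_in)) /relabel coords_mon.
exact: of_coords_delta.
Qed.

Lemma mon_lin_ext (U : lmodType k) (f h : A s c -> U) : linear f -> linear h ->
  (forall g i, (i < n)%N -> f (u s c g * y s c ^+ i) = h (u s c g * y s c ^+ i)) ->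
  forall a, f a = h a.
Proof.
move=> lf lh fh a; rewrite -(coordsK D hs a).
have lo := @of_coords_linear _ n _ chi s c.
rewrite -/((f \o of_coords chi s c) _) -/((h \o of_coords chi s c) _).
rewrite (lin_basis_ext (lin_comp lf lo)) (lin_basis_ext (lin_comp lh lo)).
by apply: eq_bigr => -[g i] _ /=; rewrite of_coords_delta fh.
Qed.

Lemma relabel_colinear a :
  typeI_coact D s' c' (relabel a) = tmap relabel (@id H) (typeI_coact D s c a).
Proof.
have lr := relabel_linear.
move: a; apply: mon_lin_ext => [||g i lt_in].
- exact: (lin_comp (algHom_linear (typeI_coact D s' c')) lr).
- apply: (lin_comp (tmap_linear lr (@lin_id _ _))).
  exact: (algHom_linear (typeI_coact D s c)).
rewrite relabel_mon // !typeI_coact_mon.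
have lt := tmap_linear lr (@lin_id _ H).
rewrite (big_morph _ (linD lt) (lin0 lt)); apply: eq_bigr => j _.
by rewrite (linZ lt) tmap_tens // relabel_mon // (leq_trans _ lt_in).
Qed.

End Two.

Lemma relabelK s s' c c' hs hs' :
  cancel (@relabel s s' c c' hs) (@relabel s' s c' c hs').
Proof.
have l := @relabel_linear s s' c c' hs; have l' := @relabel_linear s' s c' c hs'.
apply: (mon_lin_ext hs (lin_comp l' l) (@lin_id _ _)) => g i lt_in /=.
by rewrite !relabel_mon.
Qed.

Section One.
Variables (s : G -> G -> k) (c : k).
Hypothesis hs : normalized_cocycle s.

Lemma typeI_one_neq0 : (1 : A s c) != 0.
Proof.
apply/eqP => e; have /ffunP/(_ (1%g, Ordinal (prim_order_gt0 (md_prim D)))) :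
    delta k (1%g, Ordinal (prim_order_gt0 (md_prim D))) = 0
      :> coordSpace k (G * 'I_n)%type.
  rewrite -(coords_mon D c hs) /= ug1 expr0 mulr1 e.
  exact: (lin0 (coords_linear D hs)).
by rewrite !ffunE eqxx => /eqP; rewrite oner_eq0.
Qed.

Lemma ug_neq0 g : u s c g != 0.
Proof.
apply: contraNneq typeI_one_neq0 => e.
have := ugM n chi s c g g^-1%g; rewrite e mul0r mulgV ug1 => /esym/eqP e1.
rewrite -(scale1r (1 : A s c)) -(mulVf (cocycle_neq0 hs g g^-1%g)) -scalerA.
by rewrite (eqP e1) scaler0.
Qed.

Lemma coact_grouplike g (a : A s c) :
  typeI_coact D s c a = a ⊗ hg g -> exists t : k, a = t *: u s c g.
Proof.
move=> da; pose r := @relabel s (fun _ _ => 1) c 0 hs.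
have lr : linear r := relabel_linear _ _ hs.
have rK : cancel r (relabel s c trivial_cocycle) by exact: relabelK.
(* [r] is an isomorphism of comodules onto the Hopf algebra itself, where the
   counit turns a group-like coaction into a multiple of the group element. *)
have dr : monomial_comul D (r a) = r a ⊗ hg g.
  rewrite [LHS](relabel_colinear _ _ hs) da tmap_tens //; exact: lin_id.
have := monomial_comul_counitl D (r a); rewrite dr tcontl_tens => ra.
exists (monomial_counit D (r a) : k).
have e : r (u s c g) = hg g.
  have := @relabel_mon s (fun _ _ => 1) c 0 hs g 0 (prim_order_gt0 (md_prim D)).
  by rewrite !expr0 !mulr1.
by apply: (can_inj rK); rewrite (linZ lr) e ra.
Qed.

End One.
End Comparison.

(** * Comodule algebra maps out of the tensor algebra *)

Section FreeComoduleAlgebra.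
Variables (k : fieldType) (H : hopfAlg k) (B : comodAlg H).

(** This and [exists_comodAlgHom] are the two halves of the universal property of
    T, by which a map out of T is a family of colinear maps on H.  All identities
    below involve a single copy of H, for which constant families suffice. *)
Lemma comodAlgHom_Xvar (mu : comodAlgHom (talg H) B) i h :
  coact B (mu (Xvar i h)) = tmap (mu \o Xvar i) (@id H) (comul H h).
Proof.
rewrite comod_hom_colinear [coact _ _]talg_coactX tmap_comp //.
- exact: Xvar_linear.
- exact: (algHom_linear mu).
Qed.

Section Extend.
Variable psi : H -> B.
Hypotheses (lpsi : linear psi)
  (psi_colinear : forall h, coact B (psi h) = tmap psi (@id H) (comul H h)).

Let gen (p : nat * H) : B := psi p.2.

Let gen_rel s t : talg_rel s t -> term_eval gen s = term_eval gen t.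
Proof.
case=> [i g h|i a h] /=; first exact: (linD lpsi).
by rewrite /gen (linZ lpsi) -pzscalerAl mul1r.
Qed.

Let talg_lift : algHom (talg H) B := pres_lift gen_rel.

Let talg_liftX i h : talg_lift (Xvar i h) = psi h.
Proof. exact: (pres_lift_gen gen_rel). Qed.

Let talg_lift_colinear a :
  coact B (talg_lift a) = tmap talg_lift (@id H) (coact (talg H) a).
Proof.
pose f := alg_comp (coact B) talg_lift.
pose g := alg_comp (tmap_alg talg_lift (alg_id H)) (coact (talg H)).
apply: (@pres_hom_ext _ _ _ _ f g) => -[i h].
change (coact B (talg_lift (Xvar i h)) =
  tmap talg_lift (@id H) (talg_coact H (Xvar i h))).
rewrite talg_liftX talg_coactX psi_colinear tmap_comp //.
- by congr (tmap _ _ _); apply/funext => h'; exact/esym/talg_liftX.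
- exact: Xvar_linear.
- exact: (algHom_linear talg_lift).
Qed.

Lemma exists_comodAlgHom :
  exists mu : comodAlgHom (talg H) B, forall i h, mu (Xvar i h) = psi h.
Proof. by exists (ComodAlgHom talg_lift_colinear). Qed.

End Extend.
End FreeComoduleAlgebra.

(** * Identities that detect the parameter and the cocycle *)

(** The scalar r enters the n-th power of e y + r u through r^n u^n, and the n-th
    power of its q-commutator with t u through ((1-q) r t)^n u^(2n); the factor
    (1-q)^n (t u)^n makes the two contributions equal, so that only c remains. *)
Lemma power_identity (k : fieldType) (A : pzAlgType k) (n : nat) (q c d e r t : k)
    (y u : A) :
  n.-primitive_root q -> y * u = q *: (u * y) -> y ^+ n = c *: (1 : A) ->
  let Y := e *: y + r *: u in
  (1 - q) ^+ n *: (Y ^+ n * (t *: u) ^+ n) - (Y * (t *: u) - q *: (t *: u * Y)) ^+ n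
    - ((1 - q) ^+ n * d) *: ((e *: (1 : A)) ^+ n * (t *: u) ^+ n) =
  ((1 - q) ^+ n * (c - d) * (e * t) ^+ n) *: u ^+ n.
Proof.
move=> qn yu yn Y.
have defectE : Y * (t *: u) - q *: (t *: u * Y) = ((1 - q) * (r * t)) *: (u * u).
  rewrite /Y mulrDl mulrDr -!pzscalerAl -!pzscalerAr yu.
  rewrite scalerDr opprD !scalerA addrACA -!scaleNr -!scalerDl.
  have -> : e * t * q - q * t * e = 0 by ring.
  by rewrite scale0r add0r; congr (_ *: _); ring.
have Yn : Y ^+ n = (e ^+ n * c) *: (1 : A) + r ^+ n *: u ^+ n.
  rewrite (qbinomial_prim qn) ?pz_exprZn ?yn ?scalerA //.
  by rewrite -!pzscalerAl -!pzscalerAr yu !scalerA; congr (_ *: _); ring.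
have uun : (u * u) ^+ n = u ^+ n * u ^+ n.
  by rewrite -exprD addnn -mul2n exprM expr2.
rewrite defectE Yn !pz_exprZn uun expr1n mulrDl -!pzscalerAl -!pzscalerAr.
rewrite !mul1r scalerDr !scalerA -!scaleNr addrAC -addrA addrACA -!scalerDl.
rewrite [Z in _ + Z *: _](_ : _ = 0) ?scale0r ?addr0; last by rewrite !exprMn; ring.
by congr (_ *: _); rewrite exprMn; ring.
Qed.

Section Identities.
Variables (k : fieldType) (n : nat) (G : finGroupType) (chi : G -> k).
Variables (q : k) (x : G).
Hypotheses (hn : (2 <= n)%N) (D : monomial_datum n q x chi).
Local Notation A s c := (typeI_alg n chi s c).
Local Notation u s c := (ug n chi s c : G -> A s c).
Local Notation y s c := (uy n chi s c : A s c).
Local Notation H := (monomial_alg n chi).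
Local Notation hg := (ug n chi (fun _ _ => 1) 0 : G -> H).
Local Notation hy := (uy n chi (fun _ _ => 1) 0 : H).
Local Notation HH := (monomialHopf D).
Local Notation AA s c := (typeI_comodAlg D s c).
Local Notation X h := (@Xvar k HH 0 h).

Lemma q_neq1 : 1 - q != 0.
Proof.
apply: contraTneq hn => /subr0_eq q1.
by rewrite -leqNgt dvdn_leq // (prim_order_dvd (md_prim D)) expr1 -q1.
Qed.

Section One.
Variables (s : G -> G -> k) (c : k).
Hypothesis hs : normalized_cocycle s.

Lemma hom_grouplike (mu : comodAlgHom (talg HH) (AA s c)) g :
  exists t : k, mu (X (hg g)) = t *: u s c g.
Proof.
apply: (@coact_grouplike _ _ _ _ _ _ D s c hs g).
apply: (etrans (comodAlgHom_Xvar mu 0 (hg g))).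
rewrite [comul _ _]typeI_coact_ug tmap_tens //.
exact: (lin_comp (algHom_linear mu) (@Xvar_linear _ _ _)).
Qed.

(** Subtracting e u_y, which has the same y-part of the coaction as mu(X^y), leaves
    an element with coaction a |-> a ⊗ x. *)
Lemma hom_skew_primitive (mu : comodAlgHom (talg HH) (AA s c)) :
  exists e r : k, mu (X (hg 1%g)) = e *: (1 : A s c) /\
    mu (X hy) = e *: y s c + r *: u s c x.
Proof.
have [e mu1] := hom_grouplike mu 1%g; rewrite !ug1 in mu1 *.
have lX := lin_comp (algHom_linear mu) (@Xvar_linear _ HH 0).
have muy : typeI_coact D s c (mu (X hy)) =
    (e *: (1 : A s c)) ⊗ hy + (mu (X hy) : A s c) ⊗ hg x.
  apply: (etrans (comodAlgHom_Xvar mu 0 hy)).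
  rewrite [comul _ _]typeI_coact_uy (linD (tmap_linear lX (@lin_id _ H))).
  by rewrite !tmap_tens // -mu1.
have [|r er] := @coact_grouplike _ _ _ _ _ _ D s c hs x (mu (X hy) - e *: y s c).
  have ld := algHom_linear (typeI_coact D s c).
  rewrite -scaleNr addrC ld [Z in _ + Z]muy typeI_coact_uy.
  rewrite scalerDr scaleNr tensZl scaleNr addrACA addNr add0r.
  by rewrite tensDl -scaleNr tensZl.
exists e, r; split=> //.
by rewrite -er addrC subrK.
Qed.

Lemma exists_hom : exists mu : comodAlgHom (talg HH) (AA s c),
  (forall g, mu (X (hg g)) = u s c g) /\ mu (X hy) = y s c.
Proof.
have ht := @trivial_cocycle k G.
have lr := @relabel_linear _ _ _ _ _ _ D _ s 0 c ht.
have r_mon := @relabel_mon _ _ _ _ _ _ D _ s 0 c ht.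
have r_colinear := @relabel_colinear _ _ _ _ _ _ D _ s 0 c ht.
have [mu muX] := exists_comodAlgHom (B := AA s c) lr r_colinear.
exists mu; split=> [g|]; rewrite muX.
  by have := r_mon g 0%N (ltnW hn); rewrite !expr0 !mulr1.
by have := r_mon 1%g 1%N hn; rewrite !ug1 !mul1r.
Qed.

Lemma prod_ug w : \prod_(g <- w) u s c g = wt s w *: u s c (wprod w).
Proof.
elim: w => [|g w IH]; first by rewrite !big_nil scale1r ug1.
by rewrite !big_cons IH -pzscalerAr ugM scalerA mulrC.
Qed.

Lemma prod_ug_neq0 w : \prod_(g <- w) u s c g != 0.
Proof.
have u0 : u s c (wprod w) != 0 by exact: (ug_neq0 D c hs).
rewrite prod_ug; apply: contraNneq u0 => wu0.
by rewrite -[u s c _]scale1r -(mulVf (wt_neq0 hs w)) -scalerA wu0 scaler0.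
Qed.

End One.

Definition wordX (w : seq G) : talg HH := \prod_(g <- w) X (hg g).

Lemma hom_wordX (s : G -> G -> k) (c : k)
    (mu : comodAlgHom (talg HH) (AA s c)) (t : G -> k) w :
  (forall g, mu (X (hg g)) = t g *: u s c g) ->
  mu (wordX w) = (\prod_(g <- w) t g * wt s w) *: u s c (wprod w).
Proof.
move=> muX; rewrite /wordX.
transitivity (\prod_(g <- w) (t g *: u s c g)).
  rewrite (big_morph _ (algHom_mul mu) (algHom_one mu)).
  by apply: eq_bigr => g _; exact: muX.
rewrite -scalerA -prod_ug; elim: w => [|g w IH]; first by rewrite !big_nil scale1r.
by rewrite !big_cons IH -pzscalerAl -pzscalerAr scalerA.
Qed.

Definition word_swap (s : G -> G -> k) (w w' : seq G) : talg HH :=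
  wt s w' *: wordX w - wt s w *: wordX w'.

(** A permutation of the word permutes the scalars t_g with mu(X^g) = t_g u_g, and
    leaves their product unchanged. *)
Lemma word_swap_id s c w w' : normalized_cocycle s ->
  perm_eq w w' -> wprod w = wprod w' -> polyId (AA s c) (word_swap s w w').
Proof.
move=> hs ww' prodE mu; have [t muX] := choice (hom_grouplike hs mu).
have lm := algHom_linear mu.
rewrite /word_swap (linD lm) -scaleNr !(linZ lm) !(hom_wordX _ muX) prodE.
rewrite (perm_big _ ww') /= !scalerA -scalerDl.
by rewrite -[RHS](scale0r (u s c (wprod w'))); congr (_ *: _); ring.
Qed.

(** With all scalars t_g equal to 1, vanishing compares the two weights. *)
Lemma word_swap_inv s s' c' w w' : normalized_cocycle s' ->
  wprod w = wprod w' -> polyId (AA s' c') (word_swap s w w') ->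
  wt s w' * wt s' w = wt s w * wt s' w'.
Proof.
move=> hs' prodE ww'_id; have [mu [muX _]] := exists_hom s' c'.
have {}muX g : mu (X (hg g)) = 1 *: u s' c' g by rewrite scale1r.
have lm := algHom_linear mu.
have := ww'_id mu; rewrite /word_swap (linD lm) -scaleNr !(linZ lm).
rewrite !(hom_wordX _ muX) prodE !big1_eq !mul1r !scalerA -scalerDl => e.
apply/eqP; rewrite -subr_eq0 -mulNr; apply: contraT => ne0.
have /negP[] := ug_neq0 D c' hs' (wprod w'); apply/eqP.
by rewrite -[LHS]scale1r -(mulVf ne0) -scalerA e scaler0.
Qed.

Definition yX_defect : talg HH := X hy * X (hg x) - q *: (X (hg x) * X hy).

Definition power_poly (c : k) : talg HH :=
  (1 - q) ^+ n *: (X hy ^+ n * X (hg x) ^+ n) - yX_defect ^+ n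
  - ((1 - q) ^+ n * c) *: (X (hg 1%g) ^+ n * X (hg x) ^+ n).

Lemma hom_power_poly s c (mu : comodAlgHom (talg HH) (AA s c)) (d e r t : k) :
  mu (X (hg 1%g)) = e *: (1 : A s c) ->
  mu (X (hg x)) = t *: u s c x ->
  mu (X hy) = e *: y s c + r *: u s c x ->
  mu (power_poly d) = ((1 - q) ^+ n * (c - d) * (e * t) ^+ n) *: u s c x ^+ n.
Proof.
move=> mu1 mux muy; have lm := algHom_linear mu.
rewrite /power_poly /yX_defect !(linD lm) -!scaleNr -[- _ ^+ n]scaleN1r.
rewrite !(linZ lm).
rewrite !algHom_mul !alg_exp (linD lm) !(linZ lm) !algHom_mul mu1 mux muy.
rewrite scaleN1r !scaleNr.
have yu : y s c * u s c x = q *: (u s c x * y s c) by rewrite uyg (md_chix D).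
exact: (power_identity d e r t (md_prim D) yu (uyX n chi s c)).
Qed.

Lemma power_poly_id s c : normalized_cocycle s -> polyId (AA s c) (power_poly c).
Proof.
move=> hs mu; have [e [r [mu1 muy]]] := hom_skew_primitive hs mu.
have [t mux] := hom_grouplike hs mu x.
by rewrite (hom_power_poly _ mu1 mux muy) subrr mulr0 mul0r scale0r.
Qed.

(** The map with e = t = 1 and r = 0 sends the polynomial of parameter d to a
    nonzero multiple of (c - d) u_x^n. *)
Lemma power_poly_inv s c d : normalized_cocycle s ->
  polyId (AA s c) (power_poly d) -> c = d.
Proof.
move=> hs d_id; have [mu [muX muy]] := exists_hom s c.
have mu1 : mu (X (hg 1%g)) = 1 *: (1 : A s c) by rewrite muX ug1 scale1r.
have mux : mu (X (hg x)) = 1 *: u s c x by rewrite muX scale1r.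
have {}muy : mu (X hy) = 1 *: y s c + 0 *: u s c x by rewrite muy scale1r scale0r addr0.
have := d_id mu; rewrite (hom_power_poly _ mu1 mux muy) mulr1 expr1n mulr1 => e.
apply/eqP; rewrite -subr_eq0; apply: contraT => cd.
have ne0 : (1 - q) ^+ n * (c - d) != 0 by rewrite mulf_neq0 ?expf_neq0 ?q_neq1.
have /negP[] := prod_ug_neq0 c hs (nseq n x); apply/eqP.
rewrite big_nseq iter_mulr_1.
by rewrite -[LHS]scale1r -(mulVf ne0) -scalerA e scaler0.
Qed.

(** The equation on [lam] is what the elements lam g *: u'_g need to satisfy the
    relations of the u_g; at g = h = 1 it forces lam 1 = 1. *)
Lemma cohomologous_hom s s' c (lam : G -> k) :
  normalized_cocycle s -> normalized_cocycle s' ->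
  (forall g h, lam g * lam h * s' g h = s g h * lam (g * h)%g) ->
  (forall g, lam g != 0) ->
  exists f : comodAlgHom (AA s c) (AA s' c),
    (forall g, f (u s c g) = lam g *: u s' c g) /\ f (y s c) = y s' c.
Proof.
move=> hs hs' lamM lam0.
pose e g : A s' c := lam g *: u s' c g.
have e1 : e 1%g = 1.
  rewrite /e ug1; suff -> : lam 1%g = 1 by rewrite scale1r.
  apply: (mulfI (lam0 1%g)); have := lamM 1%g 1%g.
  by rewrite (cocycle_1l hs) (cocycle_1l hs') !mulr1 mul1r mulg1.
have eM g h : e g * e h = s g h *: e (g * h)%g.
  by rewrite /e -pzscalerAl -pzscalerAr ugM !scalerA lamM.
have ye g : y s' c * e g = chi g *: (e g * y s' c).
  by rewrite /e -pzscalerAl -pzscalerAr uyg !scalerA mulrC.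
pose f : algHom (A s c) (A s' c) := typeI_lift e1 eM (uyX n chi s' c) ye.
have fg g : f (u s c g) = e g by exact: typeI_lift_ug.
have fy : f (y s c) = y s' c by exact: typeI_lift_uy.
have f_colin a : typeI_coact D s' c (f a) = tmap f (@id H) (typeI_coact D s c a).
  have lf := algHom_linear f; have lH := @lin_id _ H.
  apply: (@typeI_hom_ext _ _ _ _ _ _ _ (alg_comp (typeI_coact D s' c) f)
    (alg_comp (tmap_alg f (alg_id H)) (typeI_coact D s c))) => [g|].
  - change (typeI_coact D s' c (f (u s c g)) =
      tmap f (@id H) (typeI_coact D s c (u s c g))).
    rewrite fg typeI_coact_ug tmap_tens // fg /e.
    by rewrite (linZ (algHom_linear _)) typeI_coact_ug tensZl.
  - change (typeI_coact D s' c (f (y s c)) =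
      tmap f (@id H) (typeI_coact D s c (y s c))).
    rewrite fy !typeI_coact_uy (linD (tmap_linear lf lH)) !tmap_tens //.
    by rewrite fy algHom_one.
by exists (@ComodAlgHom _ _ (AA s c) (AA s' c) f f_colin).
Qed.

Lemma cohomologous_iso s s' c (lam : G -> k) :
  normalized_cocycle s -> normalized_cocycle s' ->
  (forall g h, lam g * lam h * s' g h = s g h * lam (g * h)%g) ->
  (forall g, lam g != 0) -> comodAlg_isomorphic (AA s c) (AA s' c).
Proof.
move=> hs hs' lamM lam0.
have [f [fg fy]] := cohomologous_hom c hs hs' lamM lam0.
have lamVM g h : (lam g)^-1 * (lam h)^-1 * s g h = s' g h * (lam (g * h)%g)^-1.
  apply: (mulfI (mulf_neq0 (mulf_neq0 (lam0 g) (lam0 h)) (lam0 (g * h)%g))).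
  have -> : lam g * lam h * lam (g * h)%g * ((lam g)^-1 * (lam h)^-1 * s g h) =
     s g h * lam (g * h)%g by field; rewrite !lam0.
  by rewrite -lamM; field.
have [f' [f'g f'y]] := cohomologous_hom c hs' hs lamVM (fun g => invr_neq0 (lam0 g)).
exists f; exists f' => a.
- apply: (@typeI_hom_ext _ _ _ _ _ _ _ (alg_comp f' f) (alg_id _)) => [g|].
    change (f' (f (u s c g)) = u s c g).
    by rewrite fg (linZ (algHom_linear f')) f'g scalerA mulfV // scale1r.
  by change (f' (f (y s c)) = y s c); rewrite fy f'y.
apply: (@typeI_hom_ext _ _ _ _ _ _ _ (alg_comp f f') (alg_id _)) => [g|].
  change (f (f' (u s' c g)) = u s' c g).
  by rewrite f'g (linZ (algHom_linear f)) fg scalerA mulVf // scale1r.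
by change (f (f' (y s' c)) = y s' c); rewrite f'y fy.
Qed.

End Identities.

(** * The theorem *)

Section Quotient.
Variables (k : fieldType) (G : finGroupType) (s s' : G -> G -> k).
Hypotheses (hs : normalized_cocycle s) (hs' : normalized_cocycle s').

Lemma quotient_cocycle : normalized_cocycle (fun g h => s g h / s' g h).
Proof.
have s'0 := cocycle_neq0 hs'.
split=> [g h|g h l|g|g].
- by rewrite mulf_neq0 ?invr_neq0 // (cocycle_neq0 hs).
- by rewrite !mulf_div (cocycle_eq hs) (cocycle_eq hs').
- by rewrite (cocycle_1l hs) (cocycle_1l hs') divr1.
- by rewrite (cocycle_1r hs) (cocycle_1r hs') divr1.
Qed.

Lemma wt_quotient w : wt (fun g h => s g h / s' g h) w = wt s w / wt s' w.
Proof. by elim: w => [|g w IH] /=; rewrite ?divr1 // IH mulf_div. Qed.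

End Quotient.

Theorem theorem3p4 (k : closedFieldType) (n : nat) (q : k)
    (G : finGroupType) (x : G) (chi : G -> k)
    (hn : (2 <= n)%N)
    (hchar : forall p : nat, p \in [pchar k] -> ~~ (p %| n)%N)
    (D : monomial_datum n q x chi)
    (sigma sigma' : G -> G -> k)
    (hsigma : normalized_cocycle sigma) (hsigma' : normalized_cocycle sigma')
    (c c' : k) :
  polyId (typeI_comodAlg D sigma c) = polyId (typeI_comodAlg D sigma' c') ->
  comodAlg_isomorphic (typeI_comodAlg D sigma c) (typeI_comodAlg D sigma' c').
Proof.
move=> idE.
have cc' : c' = c.
  apply: (power_poly_inv hn hsigma' (D := D)).
  by rewrite -idE; exact: power_poly_id.
subst c'.
have [|lam lam0 lamM] := coboundary_of_words (quotient_cocycle hsigma hsigma').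
  move=> w w' ww' prodE; rewrite !wt_quotient.
  apply/eqP; rewrite eqr_div ?(wt_neq0 hsigma') //; apply/eqP.
  have /(word_swap_inv hn hsigma' prodE) :
      polyId (typeI_comodAlg D sigma' c) (word_swap D sigma w w').
    by rewrite -idE; exact: word_swap_id.
  by move=> e; rewrite -e mulrC.
apply: (cohomologous_iso D c hsigma hsigma' _ lam0) => g h.
by rewrite lamM mulrAC divfK // (cocycle_neq0 hsigma').
Qed.
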